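(* Let $n$ be a positive integer and let $I^n$ be the $n$-dimensional cube. The number of acyclic digraphs with $n$ labeled nodes is equal to the number of Davis-Januszkiewicz equivalence classes of all small covers over $I^n$.
   Context: $\mathbb{Z}_2$ denotes the group (field) with two elements. Digraphs: a digraph on labeled nodes $1,\dots,n$ has at most one edge directed from vertex $i$ to vertex $j$, for each $1\le i\le n$, $1\le j\le n$. It is acyclic if it has no directed cycle of any length (in particular no loops and no directed 2-cycles). Acyclic digraphs with labeled nodes are counted without identifying isomorphic ones. Small covers: let $P$ be a simple convex polytope of dimension $n$. The standard action of $\mathbb{Z}_2^n$ on $\mathbb{R}^n$ is by sign changes of the coordinates; a $\mathbb{Z}_2^n$-action on an $n$-manifold is locally standard if it is locally isomorphic, up to an automorphism of $\mathbb{Z}_2^n$, to the standard action. A small cover over $P$ is a smooth closed manifold $M$ of dimension $n$ with a locally standard $\mathbb{Z}_2^n$-action whose orbit space is $P$ (identified as a manifold with corners); it thus comes with a projection $\pi: M\to P$ whose fibers are the orbits. Davis-Januszkiewicz equivalence: two small covers $\pi_1:M_1\to P$ and $\pi_2:M_2\to P$ are Davis-Januszkiewicz (D-J) equivalent if there are an automorphism $\varphi$ of $\mathbb{Z}_2^n$ and a homeomorphism $f: M_1\to M_2$ such that $f(t\cdot x)=\varphi(t)\cdot f(x)$ for all $t\in\mathbb{Z}_2^n$, $x\in M_1$, and $f$ covers the identity on $P$, i.e. $\pi_2\circ f=\pi_1$. *)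

(* Defs.v *)
From HB Require Import structures.
From mathcomp Require Import all_boot all_order all_algebra.
From mathcomp Require Import all_classical all_reals all_analysis.

Set Implicit Arguments.
Unset Strict Implicit.
Unset Printing Implicit Defensive.

Import Order.TTheory GRing.Theory Num.Theory.
Import numFieldNormedType.Exports.

Local Open Scope classical_set_scope.
Local Open Scope ring_scope.

(* A digraph is its set of edges; loops (i, i) are allowed. *)
Definition digraph (n : nat) := {set 'I_n * 'I_n}.

Definition edge n (E : digraph n) : rel 'I_n := fun i j => (i, j) \in E.

(* [ucycle e [::]] holds by convention.  [ucycle e [:: i]] is a loop at i and
   [ucycle e [:: i; j]] a directed 2-cycle. *)
Definition acyclic n (E : digraph n) : Prop :=
  forall c : seq 'I_n, ucycle (edge E) c -> c = [::].

Definition acyclic_digraphs n : {set digraph n} :=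
  [set E : digraph n | `[< acyclic E >]]%SET.

Section Smooth.
Variables (R : realType) (n : nat).
Implicit Types (U : set 'rV[R]_n) (f : 'rV[R]_n -> 'rV[R]_n).

(* For U open. *)
Fixpoint Ck_on (k : nat) U f : Prop :=
  {in U, continuous f} /\
  if k is k'.+1 then
    forall i : 'I_n, (forall x, U x -> derivable f x (delta_mx 0 i)) /\
                     Ck_on k' U ('D_(delta_mx 0 i) f)
  else True.

Definition smooth_on U f : Prop := forall k, Ck_on k U f.

(* A homeomorphism between an open subset of M and an open subset of R^n; the
   values of the two maps outside these subsets are irrelevant. *)
Record chart (M : topologicalType) := Chart {
  dom : set M;
  cod : set 'rV[R]_n;
  local_coord : M -> 'rV[R]_n;
  param : 'rV[R]_n -> M;
  dom_open : open dom;
  cod_open : open cod;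
  local_coord_cod : forall x, dom x -> cod (local_coord x);
  param_dom : forall y, cod y -> dom (param y);
  local_coordK : {in dom, cancel local_coord param};
  paramK : {in cod, cancel param local_coord};
  local_coord_continuous : {in dom, continuous local_coord};
  param_continuous : {in cod, continuous param} }.

Definition smooth_transition M (c d : chart M) : Prop :=
  smooth_on (cod c `&` param c @^-1` dom d) (local_coord d \o param c).

Definition compatible M (c d : chart M) : Prop :=
  smooth_transition c d /\ smooth_transition d c.

(* Second countability follows from compactness and local charts. *)
Record closed_manifold := ClosedManifold {
  carrier :> topologicalType;
  atlas : set (chart carrier);
  carrier_hausdorff : hausdorff_space carrier;
  carrier_compact : compact [set: carrier];
  atlas_cover : forall x, exists2 c, atlas c & dom c x;
  atlas_compatible : forall c d, atlas c -> atlas d -> compatible c d }.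

(* The charts of the maximal smooth atlas. *)
Definition smooth_chart (M : closed_manifold) (c : chart M) : Prop :=
  forall d, atlas d -> compatible c d.

End Smooth.

(* Z_2^n is written additively. *)
Definition Z2 (n : nat) := 'rV['F_2]_n.

Section SmallCover.
Variables (R : realType) (n : nat).

Definition std_act (t : Z2 n) (y : 'rV[R]_n) : 'rV[R]_n :=
  \row_i (if t 0 i == 0 then y 0 i else - y 0 i).

Definition is_aut (phi : {additive Z2 n -> Z2 n}) : Prop := bijective phi.

(* A diffeomorphism from an invariant open subset of M onto an open subset of
   R^n which carries the action to the standard one, up to an automorphism of
   Z_2^n. *)
Definition standard_chart (M : closed_manifold R n) (act : Z2 n -> M -> M)
    (c : chart R n M) : Prop :=
  [/\ smooth_chart c,
      forall t x, dom c x -> dom c (act t x)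
    & exists2 phi : {additive Z2 n -> Z2 n}, is_aut phi &
        forall t x, dom c x ->
          local_coord c (act t x) = std_act (phi t) (local_coord c x)].

Definition cube : set 'rV[R]_n := [set p | forall i, 0 <= p 0 i <= 1].

(* The codimension of the smallest face of the cube containing p. *)
Definition cube_codim (p : 'rV[R]_n) : nat :=
  #|[pred i : 'I_n | (p 0 i == 0) || (p 0 i == 1)]|.

(* The orbit space of the standard action is the orthant [0, +oo[^n, where the
   codimension of the face through the orbit of y is the number of zero
   coordinates of y. *)
Definition orthant_codim (y : 'rV[R]_n) : nat := #|[pred i : 'I_n | y 0 i == 0]|.

(* By [sc_standard] every element of Z_2^n acts by a diffeomorphism.
   By [sc_proj_continuous], [sc_proj_range] and [sc_proj_fiber], the projection
   induces a continuous bijection from the orbit space onto the cube, hence a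
   homeomorphism since M is compact; [sc_proj_corners] says that it identifies
   the two as manifolds with corners, i.e. preserves the codimension of
   faces. *)
Record small_cover := SmallCover {
  sc_manifold :> closed_manifold R n;
  sc_act : Z2 n -> sc_manifold -> sc_manifold;
  sc_act0 : forall x, sc_act 0 x = x;
  sc_actD : forall s t x, sc_act (s + t) x = sc_act s (sc_act t x);
  sc_standard : forall x, exists2 c, standard_chart sc_act c & dom c x;
  sc_proj : sc_manifold -> 'rV[R]_n;
  sc_proj_continuous : continuous sc_proj;
  sc_proj_range : range sc_proj = cube;
  sc_proj_fiber : forall x y,
    sc_proj x = sc_proj y <-> exists t, y = sc_act t x;
  sc_proj_corners : forall c x, standard_chart sc_act c -> dom c x ->
    orthant_codim (local_coord c x) = cube_codim (sc_proj x) }.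

Definition homeomorphism (M N : topologicalType) (f : M -> N) : Prop :=
  continuous f /\
  exists g : N -> M, [/\ continuous g, cancel f g & cancel g f].

Definition DJ_equiv (M N : small_cover) : Prop :=
  exists phi : {additive Z2 n -> Z2 n}, exists f : M -> N,
    [/\ is_aut phi, homeomorphism f,
        forall t x, f (sc_act t x) = sc_act (phi t) (f x)
      & forall x, sc_proj (f x) = sc_proj x].

End SmallCover.

Lemma is_aut_inv n (phi : {additive Z2 n -> Z2 n}) : is_aut phi ->
  exists psi : {additive Z2 n -> Z2 n}, cancel phi psi /\ cancel psi phi.
Proof.
case=> g gK Kg.
have ga : zmod_morphism g.
  by move=> x y; apply: (can_inj gK); rewrite raddfB !Kg.
pose a := GRing.isZmodMorphism.Build _ _ g ga.
pose G : {additive Z2 n -> Z2 n} := HB.pack g a.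
by exists G.
Qed.

Lemma DJ_refl (R : realType) n (M : small_cover R n) : DJ_equiv M M.
Proof.
have cid : continuous (@idfun M) by move=> x; exact: cvg_id.
exists idfun, idfun; split=> //.
by split=> //; exists idfun.
Qed.

Lemma DJ_sym (R : realType) n (M N : small_cover R n) :
  DJ_equiv M N -> DJ_equiv N M.
Proof.
case=> phi [f [pa [fc [g [gc fK gK]]] fe fp]].
have [psi [pK Kp]] := is_aut_inv pa.
exists psi, g; split.
- by exists phi.
- by split=> //; exists f.
- by move=> t x; apply: (can_inj fK); rewrite fe !gK Kp.
- by move=> x; rewrite -fp gK.
Qed.

Lemma DJ_trans (R : realType) n (M N P : small_cover R n) :
  DJ_equiv M N -> DJ_equiv N P -> DJ_equiv M P.
Proof.
case=> phi [f [pa [fc [g [gc fK gK]]] fe fp]].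
case=> phi' [f' [pa' [fc' [g' [gc' fK' gK']]] fe' fp']].
exists (phi' \o phi), (f' \o f); split.
- exact: bij_comp.
- split; first by move=> x; apply: continuous_comp; [exact: fc|exact: fc'].
  exists (g \o g'); split; [|exact: can_comp|exact: can_comp].
  by move=> x; apply: continuous_comp; [exact: gc'|exact: gc].
- by move=> t x /=; rewrite fe fe'.
- by move=> x /=; rewrite fp' fp.
Qed.

(* The equivalence classes of [rel] are the predicates [rel x].  They are not
   gathered in a [set (set T)] because [small_cover], which quantifies over
   topological types, lives in too large a universe. *)
Definition is_class (T : Type) (rel : T -> T -> Prop) (C : T -> Prop) : Prop :=
  exists x, C = rel x.

Definition has_classes (T : Type) (rel : T -> T -> Prop) (N : nat) : Prop :=
  exists F : 'I_N -> T -> Prop,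
    injective F /\ forall C, is_class rel C <-> exists i, C = F i.

(* Main.v *)
From HB Require Import structures.
Require Import Defs.
From mathcomp Require Import all_boot all_order all_algebra.
From mathcomp Require Import all_classical all_reals all_analysis.
From mathcomp Require Import zify ring lra.

(** A small cover over the cube is determined, up to Davis-Januszkiewicz
    equivalence, by its isotropy groups.  Over the relative interior of a facet
    the isotropy group is constant and has exactly one nonzero element, the
    value of the characteristic function on that facet ([char_fun_exists]); the
    isotropy group of any other point is spanned by the values on the facets
    through it ([isotropy_span]), so that at each vertex these values form a
    basis of [Z_2^n].

    The converse direction, from isotropy groups to the small cover, rests on a
    continuous section of the orbit projection ([section_exists]).  Local
    sections come from standard charts; two sections over a convex set meeting
    the open cube differ by a single group element ([sections_differ]), so local
    sections can be adjusted and glued along one coordinate after the other.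
    Given sections [s] and [s'] of two small covers whose isotropy groups
    correspond under an automorphism [phi], the rule [t . s(p) |-> phi(t) .
    s'(p)] is an equivalence ([DJ_of_isotropy]).

    For the facets [p_i = 0], which meet at the origin, an automorphism of
    [Z_2^n] makes the values of the characteristic function equal to the
    standard basis vectors [e_i], and it is the only one that does.  The values
    on the opposite facets [p_i = 1] can then be written [e_i + b_i], and the
    [b_i] are the rows of the adjacency matrix of a digraph.  The condition at
    the vertices says exactly that this digraph is acyclic: a cycle of minimal
    support gives a linear relation at a vertex ([span_acyclic]).

    Conversely each acyclic digraph is realized ([bott_cover]).  Let [B] be its
    adjacency matrix.  The reflections of [R^n] in the hyperplanes [x_i = k],
    with [k] an integer, generate a group with the cube as a fundamental domain;
    mapping the reflection in [x_i = 0] to [e_i] and the one in [x_i = 1] to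
    [e_i + b_i] defines a homomorphism to [Z_2^n], whose kernel consists of the
    maps [x |-> (-1)^(m B) x + 2 m] for [m] in [Z^n].  Acyclicity makes the
    kernel act freely, every nontrivial element moving each point by at least 2
    ([deck_far]); the small cover is the quotient of [R^n] by the kernel, a real
    Bott manifold, on which [Z_2^n] acts by sign changes. *)

Set Implicit Arguments.
Unset Strict Implicit.
Unset Printing Implicit Defensive.

Import Order.TTheory GRing.Theory Num.Theory.
Import numFieldNormedType.Exports.

Local Open Scope classical_set_scope.
Local Open Scope ring_scope.

(** * Acyclic digraphs and vectors over F_2 *)

Section Acyclic.
Variables (n : nat) (E : digraph n).

Definition pred_closed (S : {set 'I_n}) :=
  [forall (j | j \in S), exists (i | i \in S), edge E i j].

Lemma pred_closedP (S : {set 'I_n}) :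
  reflect (forall j, j \in S -> exists2 i, i \in S & edge E i j)
    (pred_closed S).
Proof.
apply: (iffP forall_inP) => H j jS; have := H j jS; first by move/exists_inP.
by case=> i iS e; apply/exists_inP; exists i.
Qed.

Definition pred_choice (S : {set 'I_n}) (f : 'I_n -> 'I_n) :=
  forall j, j \in S -> f j \in S /\ edge E (f j) j.

Lemma pred_choice_exists (S : {set 'I_n}) :
  pred_closed S -> exists f, pred_choice S f.
Proof.
move=> /pred_closedP H.
exists (fun j => odflt j [pick i in S | edge E i j]) => j jS.
case: pickP => [i /andP[]//|no]; have [i iS e] := H j jS.
by move: (no i); rewrite iS e.
Qed.

(** Iterating a predecessor function inside a nonempty pred-closed set must
    repeat a vertex, and the orbit in between is a cycle read backwards. *)
Lemma acyclicP :
  acyclic E <-> forall S, pred_closed S -> S = finset.set0.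
Proof.
split=> [acE S clS|noS c /andP[cy _]]; last first.
  apply/eqP; rewrite -[_ == _]negbK; apply/negP => cN0.
  have clc : pred_closed [set x in c].
    apply/pred_closedP => j; rewrite inE => jc; exists (prev c j).
      by rewrite inE mem_prev.
    exact: prev_cycle.
  case: c cN0 clc {cy} => //= x c _ /noS/setP/(_ x).
  by rewrite !inE eqxx.
have [f fP] := pred_choice_exists clS.
apply/eqP/set0Pn => -[j jS].
have iterS k : iter k f j \in S by elim: k => //= k /fP[].
have := looping_order f j; rewrite /looping => /trajectP[i ilt eqi].
pose x := iter i f j.
have xcyc : exists k, iter k.+1 f x = x.
  exists (order f j - i).-1; rewrite prednK ?subn_gt0//.
  by rewrite /x -iterD subnK // ltnW.
have fc : fcycle f (orbit f x) by apply/(orbitPcycle 0 3).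
have subS y : y \in orbit f x -> y \in S.
  by move=> /trajectP[k _ ->]; rewrite /x -iterD iterS.
suff /acE /(congr1 size) : ucycle (edge E) (rev (orbit f x)).
  by rewrite size_rev size_orbit /= => o0; have := order_gt0 f x; rewrite o0.
rewrite /ucycle rev_uniq orbit_uniq rev_cycle andbT.
apply: sub_in_cycle fc => [y z yS _ /eqP <-|]; first by have [] := fP y yS.
by apply/allP => y /subS.
Qed.

(** In a minimal pred-closed set every predecessor function is onto, because
    its image is pred-closed; so no two vertices can share a predecessor under
    any choice, and a vertex with two predecessors would allow that. *)
Lemma minset_indegree (S : {set 'I_n}) i i' j :
  minset [pred S | (S != finset.set0) && pred_closed S] S ->
  i \in S -> i' \in S -> j \in S -> edge E i j -> edge E i' j -> i = i'.
Proof.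
move=> minS iS i'S jS eij ei'j.
have /minsetP[/= /andP[S0 clS] Smin] := minS.
have onto f : pred_choice S f -> f @: S = S.
  move=> fP; apply: Smin; last first.
    by apply/fintype.subsetP => _ /imsetP[x xS ->]; case: (fP x xS).
  apply/andP; split.
    by apply/set0Pn; exists (f j); apply: imset_f.
  apply/pred_closedP => _ /imsetP[x xS ->]; exists (f (f x)).
    by apply: imset_f; case: (fP x xS).
  by apply: (proj2 (fP _ _)); case: (fP x xS).
have inj f : pred_choice S f -> {in S &, injective f}.
  by move=> fP; apply/imset_injP; rewrite onto.
have [f0 f0P] := pred_choice_exists clS.
pose upd k x := if x == j then k else f0 x.
have updP k : k \in S -> edge E k j -> pred_choice S (upd k).
  by move=> kS ek x xS; rewrite /upd; case: eqP => [->//|_]; exact: f0P.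
have /imsetP[j' j'S i'E] : i' \in upd i @: S by rewrite onto //; exact: updP.
move: i'E; rewrite {1}/upd; case: eqP => [_ //|/eqP nj i'E].
have := inj _ (updP i' i'S ei'j) j j' jS j'S.
rewrite /upd eqxx (negbTE nj) => /(_ i'E) jj'.
by rewrite jj' eqxx in nj.
Qed.

End Acyclic.

Lemma F2P (a : 'F_2) : a = 0 \/ a = 1.
Proof. by case: a => [[|[|//]] ?]; [left|right]; exact/val_inj. Qed.

Lemma F2_neq0 (a : 'F_2) : (a != 0) = (a == 1).
Proof. by case: (F2P a) => ->. Qed.

Lemma F2_addxx (a : 'F_2) : a + a = 0.
Proof. by case: (F2P a) => ->; exact/val_inj. Qed.

Lemma Z2_addxx n (t : Z2 n) : t + t = 0.
Proof. by apply/matrixP => i j; rewrite !mxE F2_addxx. Qed.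

Lemma Z2_opp n (t : Z2 n) : - t = t.
Proof. by apply/eqP; rewrite eq_sym -addr_eq0 Z2_addxx. Qed.

Definition digraph_of n (b : 'I_n -> Z2 n) : digraph n :=
  [set p | b p.1 0 p.2 != 0]%SET.

Lemma edge_digraph_of n (b : 'I_n -> Z2 n) i j :
  edge (digraph_of b) i j = (b i 0 j != 0).
Proof. by rewrite /edge inE. Qed.

Lemma surj_inj (T : finType) (f : T -> T) :
  (forall y, exists x, y = f x) -> injective f.
Proof.
move=> sf; have [g gK] := choice sf.
have gi : injective g by move=> x y e; rewrite (gK x) (gK y) e.
have [h hK Kh] := injF_bij gi.
suff -> : f = h by exact: can_inj Kh.
by apply/funext => x; rewrite -{1}(Kh x) -gK.
Qed.

(** If the digraph of [b] had a cycle, a minimal pred-closed set [S] would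
    have exactly one edge inside [S] into each of its vertices; over the vertex
    of the cube with support [S] the sum of the vectors [e_i + b_i], for [i]
    in [S], would then vanish on [S], hence be a combination of the [e_j] for
    [j] outside [S]. *)
Lemma span_acyclic n (b : 'I_n -> Z2 n) :
  (forall (S : {set 'I_n}) (t : Z2 n), exists u : Z2 n,
    t = \sum_j u 0 j *: (delta_mx 0 j + (if j \in S then b j else 0))) ->
  acyclic (digraph_of b).
Proof.
move=> span; apply/acyclicP => S0 clS0; apply/eqP; rewrite -[_ == _]negbK.
apply/negP => S0N0.
have [S minS _] := @minset_exists _
  [pred S | (S != finset.set0) && pred_closed (digraph_of b) S] S0
  (introT andP (conj S0N0 clS0)).
have /minsetP[/= /andP[/set0Pn[k kS] /pred_closedP clS] _] := minS.
have indeg j : j \in S -> \sum_(i in S) b i 0 j = 1.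
  move=> jS; have [i iS eij] := clS j jS.
  rewrite (bigD1 i) //= big1 ?addr0.
    by move: eij; rewrite edge_digraph_of F2_neq0 => /eqP.
  move=> i' /andP[i'S]; apply: contraNeq => e'.
  by apply/eqP/(minset_indegree minS i'S iS jS _ eij); rewrite edge_digraph_of.
pose L (u : Z2 n) : Z2 n :=
  \sum_j u 0 j *: (delta_mx 0 j + (if j \in S then b j else 0)).
have Linj : injective L by apply: surj_inj; exact: span.
(* The entries outside [S] cancel what the sum over [S] leaves there. *)
pose u : Z2 n := \row_j (if j \in S then 1 else \sum_(i in S) b i 0 j).
have L0 : L 0 = 0 by apply: big1 => j _; rewrite mxE scale0r.
suff /Linj /matrixP /(_ 0 k) : L u = L 0 by rewrite !mxE kS.
rewrite L0; apply/matrixP => o j; rewrite ord1 [RHS]mxE summxE.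
under eq_bigr => i _ do rewrite !mxE mulrDr.
rewrite big_split /= (bigD1 j) //= [X in _ + X + _]big1 ?addr0; last first.
  by move=> i; rewrite eq_sym => /negbTE ->; rewrite mulr0.
rewrite eqxx mulr1 (_ : \sum_(i < n) _ = \sum_(i in S) b i 0 j); last first.
  rewrite [RHS]big_mkcond; apply: eq_bigr => i _.
  by case: ifP => _; rewrite ?mul1r // mxE mulr0.
by case: ifP => [/indeg ->|_]; rewrite F2_addxx.
Qed.

(** * Induction along a segment, and row vectors *)

(** Real induction: the supremum of the [x] with [Q 0 x] can be passed, by the
    local hypothesis, unless it is 1.  It serves both to show that locally
    constant functions are constant and to glue sections. *)
Lemma cousin (R : realType) (Q : R -> R -> Prop) :
  (forall a c b, 0 <= a -> a < c -> c < b -> b <= 1 ->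
    Q a c -> Q c b -> Q a b) ->
  (forall x, 0 <= x <= 1 -> exists2 e, 0 < e & forall a b,
    0 <= a -> a <= x -> x <= b -> b <= 1 -> b - a < e -> Q a b) ->
  Q 0 1.
Proof.
move=> Qadd Qloc.
pose A : set R := [set x | 0 <= x <= 1 /\ (x = 0 \/ Q 0 x)].
have A0 : A 0 by split; [rewrite lexx ler01|left].
have supA : has_sup A.
  by split; [exists 0|exists 1 => x [/andP[]]].
have s01 : 0 <= sup A <= 1.
  rewrite ub_le_sup //=; last by case: supA.
  by apply: ge_sup; [exists 0|move=> x [/andP[]]].
have [e e0 Qe] := Qloc _ s01.
have e4 : 0 < e / 4 by rewrite divr_gt0.
have [a [a01 Aa] alt] := sup_adherent e4 supA.
have ale : a <= sup A by apply: ub_le_sup => //; case: supA.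
have step b : sup A <= b -> b <= 1 -> b <= sup A + e / 4 -> a < b -> Q 0 b.
  move=> sb b1 be ab.
  have Qab : Q a b by apply: Qe => //; lra.
  case: Aa => [a0|Q0a]; first by rewrite -a0.
  have [->//|aN0] := eqVneq 0 a.
  by apply: (Qadd 0 a b) => //; rewrite lt_neqAle aN0; case/andP: a01.
have [lt1|ge1] := ltP (sup A + e / 4) 1.
  have : A (sup A + e / 4).
    split; first by lra.
    by right; apply: step; lra.
  move/ub_le_sup => /(_ (proj2 supA)); lra.
have [lta1|gea1] := ltP a 1; first by apply: step => //; case/andP: s01.
have a1 : a = 1 by lra.
by case: Aa; rewrite a1 // => /eqP; rewrite oner_eq0.
Qed.

Section Convex.
Variables (R : realType) (n : nat).

Definition segment_closed (C : set 'rV[R]_n) :=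
  forall a b s, C a -> C b -> 0 <= s <= 1 -> C (a + s *: (b - a)).

Lemma locally_constant (C : set 'rV[R]_n) (T : Type) (g : 'rV[R]_n -> T) :
  segment_closed C ->
  (forall q, C q -> \forall q' \near q, C q' -> g q' = g q) ->
  forall a b, C a -> C b -> g a = g b.
Proof.
move=> convC locC a b Ca Cb.
pose p (s : R) := a + s *: (b - a).
suff : g (p 0) = g (p 1) by rewrite /p scale0r addr0 scale1r addrC subrK.
apply: (@cousin _ (fun x y => g (p x) = g (p y))) => [? ? ? _ _ _ _ ->//|x x01].
have pc : {for x, continuous p}.
  by apply: cvgD; [exact: cvg_cst|apply: cvgZr_tmp; exact: cvg_id].
have Cp s : 0 <= s <= 1 -> C (p s) by exact: convC.
have /nbhs_ballP[e e0 pe] := pc _ (locC _ (Cp _ x01)).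
exists e => // y z y0 yx xz z1 yze.
rewrite (pe y) ?(pe z) //.
- by rewrite /ball /= ler0_norm; lra.
- by apply: Cp; lra.
- by rewrite /ball /= ger0_norm; lra.
- by apply: Cp; lra.
Qed.

End Convex.

Section Segment.
Variable (R : realType).
Implicit Types (a x y s : R).

Lemma segment_gt a x y s : a < x -> a < y -> 0 <= s <= 1 -> a < x + s * (y - x).
Proof.
move=> ax ay /andP[s0 s1]; have [xy|yx] := leP x y.
  have : 0 <= s * (y - x) by rewrite mulr_ge0 ?subr_ge0.
  lra.
have : 0 <= (1 - s) * (x - y) by apply: mulr_ge0; lra.
lra.
Qed.

Lemma segment_lt a x y s : x < a -> y < a -> 0 <= s <= 1 -> x + s * (y - x) < a.
Proof.
move=> xa ya s01; have := @segment_gt (- a) (- x) (- y) s.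
rewrite !ltrN2 => /(_ xa ya s01); lra.
Qed.

Lemma segment_ge a x y s : a <= x -> a <= y -> 0 <= s <= 1 ->
  a <= x + s * (y - x).
Proof.
move=> ax ay /andP[s0 s1].
have : 0 <= s * (y - a) by apply: mulr_ge0; lra.
have : 0 <= (1 - s) * (x - a) by apply: mulr_ge0; lra.
lra.
Qed.

Lemma segment_le a x y s : x <= a -> y <= a -> 0 <= s <= 1 ->
  x + s * (y - x) <= a.
Proof.
move=> xa ya s01; have := @segment_ge (- a) (- x) (- y) s.
rewrite !lerN2 => /(_ xa ya s01); lra.
Qed.

End Segment.

Section RowTopology.
Variables (R : realType) (n : nat).
Implicit Types (x y : 'rV[R]_n).

Lemma nbhs_rowP x (A : set 'rV[R]_n) :
  nbhs x A <-> exists2 e : R, 0 < e &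
    forall y, (forall i, `|x 0 i - y 0 i| < e) -> A y.
Proof.
split=> [/nbhs_ballP[e /= e0 eA]|[e e0 eA]].
  by exists e => // y xy; apply: eA; split=> // i j; rewrite ord1; exact: xy.
apply/nbhs_ballP; exists e => //= y [_ xy]; apply: eA => i; exact: xy.
Qed.

Lemma nonexpansive_continuous (f : 'rV[R]_n -> 'rV[R]_n) :
  (forall x y e, (forall i, `|x 0 i - y 0 i| < e) ->
    forall i, `|f x 0 i - f y 0 i| < e) -> continuous f.
Proof.
move=> f1 x A /nbhs_rowP[e e0 eA]; apply/nbhs_rowP; exists e => // y xy.
by apply: eA; exact: f1.
Qed.

Lemma near_coord_neq x i (a : R) :
  x 0 i != a -> \forall y \near x, (y : 'rV[R]_n) 0 i != a.
Proof.
move=> xa; apply/nbhs_rowP; exists `|x 0 i - a|.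
  by rewrite normr_gt0 subr_eq0.
by move=> y /(_ i); apply: contraTneq => ->; rewrite ltxx.
Qed.

Definition on_facet (p : 'rV[R]_n) i := (p 0 i == 0) || (p 0 i == 1).

(** A small move cannot push a point onto a facet of the cube which it does
    not already lie on. *)
Lemma near_on_facet (p : 'rV[R]_n) :
  \forall p' \near p, forall i, on_facet p' i -> (p' : 'rV[R]_n) 0 i = p 0 i.
Proof.
apply: (@filter_forall _ _ (fun i p' => on_facet p' i -> p' 0 i = p 0 i) _
  (nbhs_filter p)) => i.
have H a : \forall p' \near p, (p' : 'rV[R]_n) 0 i = a -> p' 0 i = p 0 i.
  have [pa|pa] := eqVneq (p 0 i) a; first by near=> p' => ->.
  near=> p' => p'a; have : p' 0 i != a by near: p'; exact: near_coord_neq.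
  by rewrite p'a eqxx.
near=> p' => /orP[/eqP|/eqP]; near: p'; exact: H.
Unshelve. all: by end_near. Qed.

Lemma near_zeros y :
  \forall y' \near y, forall i, (y' : 'rV[R]_n) 0 i = 0 -> y 0 i = 0.
Proof.
apply: (@filter_forall _ _ (fun i y' => y' 0 i = 0 -> y 0 i = 0) _
  (nbhs_filter y)) => i.
have [y0|y0] := eqVneq (y 0 i) 0; first by near=> p'.
near=> y' => y'0; have : y' 0 i != 0 by near: y'; exact: near_coord_neq.
by rewrite y'0 eqxx.
Unshelve. all: by end_near. Qed.

Lemma std_act_continuous (t : Z2 n) : continuous (@std_act R n t).
Proof.
apply: nonexpansive_continuous => x y e xy i; rewrite !mxE.
case: ifP => // _; first by rewrite -opprD normrN.
Qed.

Lemma std_act_fix (t : Z2 n) y :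
  std_act t y = y <-> forall i, y 0 i != 0 -> t 0 i = 0.
Proof.
split=> [/rowP H i yi|H]; last first.
  apply/rowP => i; rewrite mxE; case: eqP => // ti.
  have [->|/H//] := eqVneq (y 0 i) 0; by rewrite oppr0.
have := H i; rewrite mxE; case: eqP => // _ /eqP.
by rewrite eqNr (negbTE yi).
Qed.

End RowTopology.

(** * Isotropy groups of a small cover *)

Lemma F2_scale n m (phi : {additive Z2 n -> Z2 m}) (a : 'F_2) t :
  phi (a *: t) = a *: phi t.
Proof.
by case: (F2P a) => ->; rewrite ?scale0r ?scale1r ?raddf0.
Qed.

Section Facets.
Variables (R : realType) (n : nat).
Implicit Types (p : 'rV[R]_n).

(** The relatively open facet [p_i = b] of the cube. *)
Definition facet (i : 'I_n) (b : bool) : set 'rV[R]_n :=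
  [set p | p 0 i = b%:R /\ forall j, j != i -> 0 < p 0 j < 1].

Definition facet_center (i : 'I_n) (b : bool) : 'rV[R]_n :=
  \row_j (if j == i then b%:R else 2^-1).

Lemma facet_center_in i b : facet i b (facet_center i b).
Proof.
split=> [|j ji]; rewrite mxE ?eqxx // (negbTE ji).
by rewrite invr_gt0 ltr0n invf_lt1 ?ltr1n.
Qed.

Lemma facet_segment i b : segment_closed (facet i b).
Proof.
move=> p q s [pi pj] [qi qj] /andP[s0 s1]; split=> [|j ji]; rewrite !mxE.
  by rewrite pi qi subrr mulr0 addr0.
have /andP[? ?] := pj j ji; have /andP[? ?] := qj j ji.
by rewrite segment_gt ?segment_lt /= ?s0 ?s1.
Qed.

Lemma facet_cube i b p : facet i b p -> cube p.
Proof.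
move=> [pi pj] j; have [->|/pj/andP[? ?]] := eqVneq j i.
  by rewrite pi; case: (b); rewrite ?lexx ler01.
by apply/andP; split; apply: ltW.
Qed.

Lemma facet_on_facet i b p j : facet i b p -> on_facet p j = (j == i).
Proof.
move=> [pi pj]; rewrite /on_facet; have [->|/pj/andP[? ?]] := eqVneq j i.
  by rewrite pi; case: (b); rewrite eqxx ?orbT.
by apply/negP => /orP[/eqP|/eqP]; lra.
Qed.

Lemma facet_codim i b p : facet i b p -> cube_codim p = 1%N.
Proof.
move=> pF; rewrite -[RHS](card1 i); apply: eq_card => j.
exact: facet_on_facet pF.
Qed.

Lemma on_facet_eq p i : on_facet p i -> p 0 i = (p 0 i == 1)%:R.
Proof. by case/orP => /eqP ->; rewrite ?eqxx // eq_sym oner_eq0. Qed.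

Lemma codim1_facet p : cube p -> cube_codim p = 1%N ->
  exists2 i, on_facet p i & facet i (p 0 i == 1) p.
Proof.
move=> pc /eqP/card1P[i pi].
have oi : on_facet p i by rewrite [on_facet _ _]pi inE.
exists i => //; split=> [|j ji]; first exact: on_facet_eq.
have : ~~ on_facet p j by rewrite [on_facet _ _]pi inE.
rewrite negb_or => /andP[j0 j1]; have /andP[jge jle] := pc j.
by rewrite !lt_neqAle eq_sym j0 j1 jge jle.
Qed.

End Facets.

Section Charts.
Variables (R : realType) (n : nat) (M : topologicalType).
Implicit Types (x : M) (t : Z2 n).

Lemma dom_nbhs (c : chart R n M) x : dom c x -> nbhs x (dom c).
Proof. by move=> dx; apply: open_nbhs_nbhs; split=> //; exact: dom_open. Qed.

Lemma local_coord_cvg (c : chart R n M) x :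
  dom c x -> local_coord c @ x --> local_coord c x.
Proof. by move=> dx; apply: local_coord_continuous; rewrite inE. Qed.

Lemma param_cvg (c : chart R n M) y :
  cod c y -> param c @ y --> param c y.
Proof. by move=> dy; apply: param_continuous; rewrite inE. Qed.

Lemma chartK (c : chart R n M) x :
  dom c x -> param c (local_coord c x) = x.
Proof. by move=> dx; apply: local_coordK; rewrite inE. Qed.

Lemma cochartK (c : chart R n M) y :
  cod c y -> local_coord c (param c y) = y.
Proof. by move=> dx; apply: paramK; rewrite inE. Qed.

Lemma standard_chart_fix (c : chart R n M) (act : Z2 n -> M -> M)
    (phi : Z2 n -> Z2 n) x t :
  (forall t x, dom c x -> dom c (act t x)) ->
  (forall t x, dom c x ->
    local_coord c (act t x) = std_act (phi t) (local_coord c x)) ->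
  dom c x ->
  act t x = x <-> forall i, local_coord c x 0 i != 0 -> phi t 0 i = 0.
Proof.
move=> inv eqv dx; rewrite -(std_act_fix (phi t) (local_coord c x)) -eqv //.
split=> [->//|e]; have da : dom c (act t x) by exact: inv.
by rewrite -(chartK da) e chartK.
Qed.

End Charts.

(** In particular the codimension of a point can be read off from the action
    alone, whatever the standard chart. *)
Lemma card_isotropy (M : topologicalType) (R : realType) n (c : chart R n M)
    (act : Z2 n -> M -> M) (phi : {additive Z2 n -> Z2 n}) (x : M) :
  is_aut phi ->
  (forall t x, dom c x -> dom c (act t x)) ->
  (forall t x, dom c x ->
    local_coord c (act t x) = std_act (phi t) (local_coord c x)) ->
  dom c x ->
  #|[set t | `[< act t x = x >]]%SET| = (2 ^ orthant_codim (local_coord c x))%N.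
Proof.
move=> aphi inv eqv dx; have [psi [phiK psiK]] := is_aut_inv aphi.
pose Z := [set i | local_coord c x 0 i == 0]%SET.
pose f (S : {set 'I_n}) : Z2 n := psi (\row_i (i \in S)%:R).
have finj : injective f.
  move=> S T /(can_inj psiK)/rowP ST; apply/setP => i; have := ST i.
  by rewrite !mxE; case: (i \in S); case: (i \in T).
rewrite (_ : [set t | _]%SET = f @: powerset Z); last first.
  apply/setP => t; rewrite inE; apply/asboolP/imsetP => [tx|[S SZ ->]].
    exists [set i | phi t 0 i != 0]%SET.
      have H := proj1 (standard_chart_fix t inv eqv dx) tx.
      rewrite powersetE; apply/fintype.subsetP => i; rewrite !inE.
      by apply: contraR => /H ->.
    apply: (can_inj phiK); rewrite psiK; apply/rowP => i; rewrite mxE inE.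
    by case: (F2P (phi t 0 i)) => ->.
  apply/(standard_chart_fix _ inv eqv dx) => i yi; rewrite psiK mxE.
  case: (boolP (i \in S)) => // iS; move: SZ; rewrite powersetE.
  by move/fintype.subsetP/(_ i iS); rewrite inE (negbTE yi).
by rewrite card_imset // card_powerset cardsE.
Qed.

Section Isotropy.
Variables (R : realType) (n : nat) (M : small_cover R n).
Implicit Types (x : M) (t : Z2 n).

Lemma sc_actK t : involutive (@sc_act _ _ M t).
Proof. by move=> x; rewrite -sc_actD Z2_addxx sc_act0. Qed.

Lemma sc_actC s t x : sc_act s (sc_act t x) = sc_act t (sc_act s x).
Proof. by rewrite -!sc_actD addrC. Qed.

Lemma sc_proj_act t x : sc_proj (sc_act t x) = sc_proj x.
Proof. by apply/esym/sc_proj_fiber; exists t. Qed.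

Lemma sc_proj_cube x : cube (sc_proj x).
Proof. by rewrite -(@sc_proj_range _ _ M); exists x. Qed.

Lemma sc_proj_onto p : cube p -> exists x, sc_proj x = p.
Proof. by rewrite -(@sc_proj_range _ _ M) => -[x _ <-]; exists x. Qed.

Lemma sc_act_continuous t : continuous (@sc_act _ _ M t).
Proof.
move=> x; have [c [_ inv [phi _ eqv]] dx] := sc_standard x.
have actE x' : dom c x' ->
    sc_act t x' = param c (std_act (phi t) (local_coord c x')).
  by move=> dx'; rewrite -eqv // chartK //; exact: inv.
apply: (@cvg_trans _
    ((fun x' => param c (std_act (phi t) (local_coord c x'))) @ x)).
  apply: near_eq_cvg; near=> x'; apply/esym/actE; near: x'; exact: dom_nbhs.
rewrite actE //; apply: (@cvg_comp _ _ _
    (fun x' => std_act (phi t) (local_coord c x')) (param c)); last first.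
  by apply: param_cvg; rewrite -eqv //; apply: local_coord_cod; exact: inv.
apply: (@cvg_comp _ _ _ (local_coord c) (std_act (phi t))).
  exact: local_coord_cvg.
exact: std_act_continuous.
Unshelve. all: by end_near. Qed.

(** The projection is closed, as a continuous map from a compact space, hence
    open, since the saturation of an open set is open. *)
Lemma sc_proj_open x (V : set M) : nbhs x V ->
  \forall q \near sc_proj x, cube q -> exists2 x', V x' & sc_proj x' = q.
Proof.
rewrite nbhsE => -[W [oW Wx] WV].
pose K := \bigcap_(t in [set: Z2 n]) ~` (sc_act t @^-1` W : set M).
have clK : closed K.
  apply: closed_bigI => t _; apply: open_closedC.
  by apply: open_comp => // x' _; exact: sc_act_continuous.
have cK : compact (@sc_proj _ _ M @` K).
  apply: continuous_compact.
    by apply: continuous_subspaceT; exact: sc_proj_continuous.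
  apply: (subclosed_compact clK (@carrier_compact _ _ M)); exact: subsetT.
have clpK := compact_closed (@norm_hausdorff _ _) cK.
have : nbhs (sc_proj x) (~` (@sc_proj _ _ M @` K)).
  apply: open_nbhs_nbhs; split; first exact: closed_openC.
  move=> [x' Kx' /sc_proj_fiber[t xE]]; apply: (Kx' t) => //.
  by rewrite /preimage /= -xE.
apply: filterS => q nKq /sc_proj_onto[x' x'q].
have [t Wt] : exists t, W (sc_act t x').
  apply: contrapT => noW; apply: nKq; exists x' => // t _ Wt; apply: noW.
  by exists t.
by exists (sc_act t x'); [exact: WV|rewrite sc_proj_act].
Qed.

(** The group is commutative, so the points of a fibre have the same isotropy
    group, which makes it a function of the point of the cube. *)
Definition isotropy (p : 'rV[R]_n) : {set Z2 n} :=
  [set t | `[< exists2 x : M, sc_proj x = p & sc_act t x = x >]]%SET.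

Lemma isotropyP x t : t \in isotropy (sc_proj x) <-> sc_act t x = x.
Proof.
rewrite inE; split=> [/asboolP[x' /sc_proj_fiber[s ->] tx']|tx].
  by rewrite sc_actC tx'.
by apply/asboolP; exists x.
Qed.

(** Nonzero coordinates remain nonzero nearby; so a nearby point of the same
    codimension has the same vanishing coordinates. *)
Lemma near_isotropy x (c : chart R n M) : standard_chart (@sc_act _ _ M) c ->
  dom c x -> \forall q \near sc_proj x, cube q ->
    cube_codim q = cube_codim (sc_proj x) -> isotropy q = isotropy (sc_proj x).
Proof.
move=> sc dx; have [_ inv [phi _ eqv]] := sc.
have V : \forall x' \near x, dom c x' /\
    (forall i, local_coord c x' 0 i = 0 -> local_coord c x 0 i = 0).
  apply: filterI; first exact: dom_nbhs.
  exact: (local_coord_cvg dx (near_zeros _)).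
apply: filterS (sc_proj_open V) => q + cq => /(_ cq)[x' [dx' zx'] <-] eqc.
have zE : [pred i | local_coord c x' 0 i == 0] =i
          [pred i | local_coord c x 0 i == 0].
  apply/subset_cardP.
    by have := sc_proj_corners sc dx; have := sc_proj_corners sc dx';
      rewrite eqc /orthant_codim => -> ->.
  by apply/fintype.subsetP => i; rewrite !inE => /eqP/zx' ->.
apply/setP => t; apply/idP/idP => /isotropyP H; apply/isotropyP.
  apply/(standard_chart_fix _ inv eqv dx) => i yi.
  move/(standard_chart_fix _ inv eqv dx') : H; apply.
  by have := zE i; rewrite !inE => ->.
apply/(standard_chart_fix _ inv eqv dx') => i yi.
move/(standard_chart_fix _ inv eqv dx) : H; apply.
by have := zE i; rewrite !inE => <-.
Qed.

Lemma facet_isotropy i b p q :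
  facet i b p -> facet i b q -> isotropy p = isotropy q.
Proof.
apply: (locally_constant (@facet_segment R n i b)) => {}p pF.
have [x xp] := sc_proj_onto (facet_cube pF).
have [c sc dx] := sc_standard x; rewrite -xp.
apply: filterS (near_isotropy sc dx) => {}q + qF; apply.
  exact: facet_cube qF.
by rewrite xp (facet_codim pF) (facet_codim qF).
Qed.

End Isotropy.

(** * Characteristic functions *)

Section Characteristic.
Variables (R : realType) (n : nat) (M : small_cover R n).

(** The characteristic function of Davis and Januszkiewicz, as a relation. *)
Definition char_fun (lam : 'I_n -> bool -> Z2 n) :=
  forall i b, lam i b != 0 /\
    forall p, facet i b p -> isotropy M p = [set 0; lam i b]%SET.

(** The hyperplane through a point of codimension 1 is the mirror of a single
    coordinate reflection of the chart. *)
Lemma codim1_isotropy (c : chart R n M) (phi psi : {additive Z2 n -> Z2 n})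
    (x : M) k :
  (forall t x, dom c x -> dom c (sc_act t x)) ->
  (forall t x, dom c x ->
    local_coord c (sc_act t x) = std_act (phi t) (local_coord c x)) ->
  cancel phi psi -> cancel psi phi -> dom c x ->
  (forall i, (local_coord c x 0 i == 0) = (i == k)) ->
  isotropy M (sc_proj x) = [set 0; psi (delta_mx 0 k)]%SET.
Proof.
move=> inv eqv phiK psiK dx zk; apply/setP => t.
apply/idP/idP => [/isotropyP/(standard_chart_fix _ inv eqv dx) H|].
  rewrite !inE.
  have tE : phi t = phi t 0 k *: delta_mx 0 k.
    apply/rowP => i; rewrite !mxE eqxx /=.
    by have [->|ik] := eqVneq i k; rewrite ?mulr1 // mulr0 H // zk.
  rewrite -(can_eq phiK) raddf0 -(can_eq phiK t) psiK tE.
  by case: (F2P (phi t 0 k)) => ->; rewrite ?scale0r ?scale1r eqxx ?orbT.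
move/set2P => tE; apply/isotropyP; apply/(standard_chart_fix _ inv eqv dx) => i.
rewrite zk => ik; case: tE => ->; rewrite ?raddf0 ?psiK !mxE //.
by rewrite (negbTE ik) andbF.
Qed.

Lemma char_fun_exists : exists lam, char_fun lam.
Proof.
suff H (ib : 'I_n * bool) : exists l : Z2 n, l != 0 /\
    forall p, facet ib.1 ib.2 p -> isotropy M p = [set 0; l]%SET.
  by have [lam lamP] := choice H; exists (fun i b => lam (i, b)) => i b.
case: ib => i b /=; have Fc := @facet_center_in R n i b.
have [x xp] := @sc_proj_onto _ _ M _ (facet_cube Fc).
have [c sc dx] := sc_standard x; have [_ inv [phi aphi eqv]] := sc.
have [psi [phiK psiK]] := is_aut_inv aphi.
have /eqP/card1P[k kP] : orthant_codim (local_coord c x) = 1%N.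
  by rewrite (sc_proj_corners sc dx) xp (facet_codim Fc).
have zk j : (local_coord c x 0 j == 0) = (j == k).
  by have := kP j; rewrite !inE.
exists (psi (delta_mx 0 k)); split=> [|p pF].
  rewrite -(can_eq phiK) psiK raddf0; apply/eqP => /rowP/(_ k).
  by rewrite !mxE !eqxx.
rewrite (facet_isotropy M pF Fc) -xp.
exact: (codim1_isotropy inv eqv phiK psiK dx zk).
Qed.

Section Span.
Variables (lam : 'I_n -> bool -> Z2 n).
Hypothesis lamP : char_fun lam.

(** The coordinate hyperplanes of a standard chart through a point are carried
    bijectively to the facets of the cube through its projection: pushing the
    other vanishing coordinates slightly off zero gives a nearby point over the
    interior of a facet, whose isotropy determines the hyperplane. *)
Lemma chart_facet (c : chart R n M) (phi psi : {additive Z2 n -> Z2 n})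
    (x : M) k :
  standard_chart (@sc_act _ _ M) c ->
  (forall t x, dom c x -> dom c (sc_act t x)) ->
  (forall t x, dom c x ->
    local_coord c (sc_act t x) = std_act (phi t) (local_coord c x)) ->
  cancel phi psi -> cancel psi phi -> dom c x ->
  local_coord c x 0 k = 0 ->
  exists2 j, on_facet (sc_proj x) j &
    phi (lam j (sc_proj x 0 j == 1)) = delta_mx 0 k.
Proof.
move=> sc inv eqv phiK psiK dx zk; set y := local_coord c x.
have cy : cod c y by exact: local_coord_cod.
have pc : sc_proj (param c y') @[y' --> y] --> sc_proj x.
  apply: cvg_comp (param_cvg cy) _; rewrite chartK //.
  exact: sc_proj_continuous.
have : \forall y' \near y, cod c y' /\
    forall i, on_facet (sc_proj (param c y')) i ->
      sc_proj (param c y') 0 i = sc_proj x 0 i.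
  apply: filterI; first by apply: open_nbhs_nbhs; split=> //; exact: cod_open.
  exact: (pc _ (near_on_facet _)).
move/nbhs_rowP => [e e0 He].
(* Only the [k]th coordinate remains zero. *)
pose y' : 'rV[R]_n :=
  \row_i (if (y 0 i == 0) && (i != k) then e / 2 else y 0 i).
have [cy' Hy'] : cod c y' /\ forall i, on_facet (sc_proj (param c y')) i ->
      sc_proj (param c y') 0 i = sc_proj x 0 i.
  apply: He => i; rewrite mxE; case: ifP => [/andP[/eqP -> _]|_].
    by rewrite sub0r normrN gtr0_norm ?divr_gt0 //; lra.
  by rewrite subrr normr0.
have zk' i : (local_coord c (param c y') 0 i == 0) = (i == k).
  rewrite cochartK // mxE; have [->|ik] := eqVneq i k.
    by rewrite andbF -/y zk eqxx.
  rewrite andbT; case: ifP => // _; apply/negbTE; by rewrite gt_eqF ?divr_gt0.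
have dy' := param_dom cy'.
have cod1 : cube_codim (sc_proj (param c y')) = 1%N.
  rewrite -(sc_proj_corners sc dy') /orthant_codim -[RHS](card1 k).
  by apply: eq_card => i; rewrite !inE zk'.
have [j oj jF] := codim1_facet (sc_proj_cube _) cod1.
have jx := Hy' j oj; rewrite jx in jF.
exists j; first by move: oj; rewrite /on_facet jx.
have := codim1_isotropy inv eqv phiK psiK dy' zk'.
have [lN0 ->] := lamP j (sc_proj x 0 j == 1); last exact: jF.
move/setP/(_ (lam j (sc_proj x 0 j == 1))).
rewrite !inE eqxx orbT (negbTE lN0) => /esym/eqP ->; exact: psiK.
Qed.

(** By [chart_facet] the coordinates of a chart that vanish at a point inject
    into the facets through it; since there are equally many of both, the values
    on these facets correspond to the vectors of the standard basis that span
    the isotropy group in the chart. *)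
Lemma isotropy_span (p : 'rV[R]_n) t : cube p ->
  t \in isotropy M p <->
  exists u : Z2 n, t = \sum_(j | on_facet p j) u 0 j *: lam j (p 0 j == 1).
Proof.
move=> /(@sc_proj_onto _ _ M)[x <-].
have [c sc dx] := sc_standard x; have [_ inv [phi aphi eqv]] := sc.
have [psi [phiK psiK]] := is_aut_inv aphi.
set p' := sc_proj x.
pose Z := [set k | local_coord c x 0 k == 0]%SET.
pose J := [set j | on_facet p' j]%SET.
have [s sP] : exists s : 'I_n -> 'I_n, forall k, k \in Z ->
    s k \in J /\ phi (lam (s k) (p' 0 (s k) == 1)) = delta_mx 0 k.
  have : forall k, exists j, k \in Z ->
      j \in J /\ phi (lam j (p' 0 j == 1)) = delta_mx 0 k.
    move=> k; have [kZ|] := boolP (k \in Z); last by exists k.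
    have zk : local_coord c x 0 k = 0 by move: kZ; rewrite inE => /eqP.
    have [j oj jE] := chart_facet sc inv eqv phiK psiK dx zk.
    by exists j; rewrite inE.
  by move=> /choice[s sP]; exists s.
have sI : {in Z &, injective s}.
  move=> k k' /sP[_ e] /sP[_ e'] ss; move: e'; rewrite -ss e => /rowP/(_ k).
  by rewrite !mxE !eqxx; case: (k =P k').
have sZ : s @: Z = J.
  apply/eqP; rewrite eqEcard card_in_imset //; apply/andP; split.
    by apply/fintype.subsetP => _ /imsetP[k /sP[? _] ->].
  have := sc_proj_corners sc dx.
  by rewrite /orthant_codim /cube_codim !cardsE => <-.
have sumE (u : Z2 n) :
    phi (\sum_(j | on_facet p' j) u 0 j *: lam j (p' 0 j == 1)) =
    \sum_(k in Z) u 0 (s k) *: delta_mx 0 k.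
  rewrite raddf_sum (eq_bigl (mem J)); last by move=> j; rewrite /= inE.
  rewrite -sZ big_imset //=; apply: eq_bigr => k kZ.
  by rewrite F2_scale; case: (sP k kZ) => _ ->.
have sumZ (v : 'I_n -> 'F_2) i :
    (\sum_(k in Z) v k *: (delta_mx 0 k : Z2 n)) 0 i =
    if i \in Z then v i else 0.
  rewrite summxE; case: ifP => iZ.
    rewrite (bigD1 i) //= big1 => [|k /andP[_ ki]]; rewrite !mxE ?eqxx.
      by rewrite mulr1 addr0.
    by rewrite eq_sym (negbTE ki) mulr0.
  apply: big1 => k kZ; rewrite !mxE.
  by case: (i =P k) => [ik|_]; [rewrite -ik iZ in kZ|rewrite andbF mulr0].
rewrite isotropyP (standard_chart_fix _ inv eqv dx); split=> [H|[u ->] i yi].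
  have [u uE] : exists u : Z2 n, forall k, k \in Z -> u 0 (s k) = phi t 0 k.
    exists (\row_j \sum_(k in Z | s k == j) phi t 0 k) => k kZ; rewrite mxE.
    rewrite (bigD1 k) /= ?kZ ?eqxx // big1 ?addr0 // => k'.
    by move=> /andP[/andP[k'Z /eqP/sI ->]]; rewrite ?eqxx.
  exists u; apply: (can_inj phiK); rewrite sumE.
  apply/rowP => i; rewrite (sumZ (fun k => u 0 (s k))).
  by case: ifP => [/uE //|]; rewrite inE => /negbT/H.
by rewrite sumE (sumZ (fun k => u 0 (s k))) inE (negbTE yi).
Qed.

End Span.
End Characteristic.

(** * Sections of the orbit projection *)

Section Sections.
Variables (R : realType) (n : nat) (M : small_cover R n).
Implicit Types (S C : set 'rV[R]_n) (s : 'rV[R]_n -> M).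

Definition open_cube : set 'rV[R]_n := [set p | forall i, 0 < p 0 i < 1].

Definition section_on S s :=
  (forall q, S q -> sc_proj (s q) = q) /\
  forall q, S q -> forall V, nbhs (s q) V ->
    \forall q' \near q, S q' -> V (s q').

Lemma section_on_sub S S' s : S' `<=` S -> section_on S s -> section_on S' s.
Proof.
move=> sub [sE sc]; split=> [q /sub/sE //|q S'q V /(sc q (sub _ S'q))].
by apply: filterS => q' + /sub; apply.
Qed.

Lemma section_on_act S s t : section_on S s -> section_on S (sc_act t \o s).
Proof.
move=> [sE sc]; split=> [q Sq|q Sq V Vq]; first by rewrite /= sc_proj_act sE.
apply: (sc q Sq (sc_act t @^-1` V)).
exact: (@sc_act_continuous _ _ M t _ _ Vq).
Qed.

Lemma hausdorff_eq (x y : M) :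
  (forall A B, nbhs x A -> nbhs y B -> exists2 z, A z & B z) -> x = y.
Proof.
move=> H; apply: (@carrier_hausdorff _ _ M) => A B xA yB.
by have [z Az Bz] := H A B xA yB; exists z.
Qed.

Lemma open_cube_free (x : M) t :
  open_cube (sc_proj x) -> sc_act t x = x -> t = 0.
Proof.
move=> ox; have [c sc dx] := sc_standard x; have [_ inv [phi aphi eqv]] := sc.
have := sc_proj_corners sc dx.
rewrite [RHS]eq_card0 => [/card0_eq z0|i]; last first.
  rewrite !inE; apply/negP; have /andP[? ?] := ox i.
  by case/orP => /eqP; lra.
move/(standard_chart_fix _ inv eqv dx) => H; apply: (bij_inj aphi).
rewrite raddf0; apply/rowP => i; rewrite H ?mxE //.
by have := z0 i; rewrite !inE => ->.
Qed.

Lemma cube_to_open (p q : 'rV[R]_n) (s : R) : cube p -> open_cube q ->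
  0 < s <= 1 -> open_cube (p + s *: (q - p)).
Proof.
move=> pc qo /andP[s0 s1] i; rewrite !mxE.
have /andP[? ?] := pc i; have /andP[? ?] := qo i.
have : 0 < s * q 0 i by apply: mulr_gt0.
have : 0 < s * (1 - q 0 i) by apply: mulr_gt0; lra.
have : 0 <= (1 - s) * p 0 i by apply: mulr_ge0; lra.
have : 0 <= (1 - s) * (1 - p 0 i) by apply: mulr_ge0; lra.
by move=> ? ? ? ?; apply/andP; split; lra.
Qed.

(** Over the open cube the group acts freely on the fibres, so two sections
    differ there by a locally constant element of the group; by continuity
    the same element works up to the boundary. *)
Lemma sections_differ C s s' :
  C `<=` @cube R n -> segment_closed C -> (C `&` open_cube) !=set0 ->
  section_on C s -> section_on C s' ->
  exists t, forall q, C q -> s' q = sc_act t (s q).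
Proof.
move=> Ccube Cseg [q0 [Cq0 oq0]] [sE sc] [sE' sc'].
have tau q : exists t, C q -> s' q = sc_act t (s q).
  have [Cq|nC] := pselect (C q); last by exists 0.
  have : sc_proj (s q) = sc_proj (s' q) by rewrite sE // sE'.
  by move/sc_proj_fiber => [t e]; exists t.
have {tau}[tau tauP] := choice tau.
(* Being different is an open condition on the values of the sections. *)
have near_ne t q : C q -> s' q <> sc_act t (s q) ->
    \forall q' \near q, C q' -> s' q' <> sc_act t (s q').
  move=> Cq ne; apply: contrapT => H; apply: ne.
  apply: hausdorff_eq => A B nA nB; apply: contrapT => AB; apply: H.
  have nB' : nbhs (s q) (sc_act t @^-1` B).
    exact: (@sc_act_continuous _ _ M t _ _ nB).
  apply: filterS2 (sc' q Cq A nA) (sc q Cq _ nB') => q' HA HB Cq' e.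
  by apply: AB; exists (s' q'); [exact: HA|rewrite e; exact: HB].
have tau_const : forall p q, (C `&` open_cube) p -> (C `&` open_cube) q ->
    tau p = tau q.
  apply: locally_constant.
    move=> a b r [Ca oa] [Cb ob] r01; split; first exact: Cseg.
    move=> i; rewrite !mxE; have /andP[? ?] := oa i; have /andP[? ?] := ob i.
    by rewrite segment_gt ?segment_lt.
  move=> q [Cq oq].
  have H : \forall q' \near q, forall t, t != tau q -> C q' ->
      s' q' <> sc_act t (s q').
    apply: (@filter_forall _ _
      (fun t q' => t != tau q -> C q' -> s' q' <> sc_act t (s q')) _
      (nbhs_filter q)) => t.
    have [->|ne] := eqVneq t (tau q); first by near=> q'.
    have ne' : s' q <> sc_act t (s q).
      rewrite tauP // => e; move/negP: ne; apply.
      rewrite -(Z2_opp (tau q)) -addr_eq0; apply/eqP.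
      apply: (@open_cube_free (s q)); first by rewrite sE.
      by rewrite sc_actD e sc_actK.
    by apply: filterS (near_ne t q Cq ne') => q' + _.
  apply: filterS H => q' H [Cq' _]; apply/eqP; apply: contrapT => /negP ne.
  by apply: (H _ ne Cq'); exact: tauP.
exists (tau q0) => q Cq; apply: contrapT => ne.
have /nbhs_rowP[e e0 He] := near_ne _ _ Cq ne.
pose r := Num.min (e / 2) 1.
have r0 : 0 < r by rewrite lt_min ltr01 divr_gt0.
have r1 : r <= 1 by rewrite ge_min lexx orbT.
have re : r <= e / 2 by rewrite ge_min lexx.
pose q' := q + r *: (q0 - q).
have Cq' : C q' by apply: Cseg => //; rewrite r1 ltW.
have oq' : open_cube q' by apply: cube_to_open => //; [exact: Ccube|rewrite r0].
apply: (He q') => // [i|]; last first.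
  by rewrite (tau_const q0 q') //; exact: tauP.
rewrite !mxE opprD addrA subrr sub0r normrN normrM gtr0_norm //.
have : `|q0 0 i - q 0 i| <= 1.
  have /andP[? ?] := oq0 i; have /andP[? ?] := Ccube _ Cq i.
  by rewrite ler_norml; apply/andP; split; lra.
by move=> /(ler_wpM2l (ltW r0)) ?; lra.
Unshelve. all: by end_near. Qed.

(** Over a small neighbourhood, lift to the unique point of the fibre whose
    coordinates in a standard chart are all nonnegative. *)
Lemma local_section (p : 'rV[R]_n) : cube p -> exists2 e, 0 < e &
  exists s, section_on
    [set q | cube q /\ forall i, `|q 0 i - p 0 i| <= e] s.
Proof.
move=> /(@sc_proj_onto _ _ M)[x xp].
have [c sc dx] := sc_standard x; have [_ inv [phi aphi eqv]] := sc.
have [psi [phiK psiK]] := is_aut_inv aphi.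
have := sc_proj_open (dom_nbhs dx); rewrite xp => /nbhs_rowP[e e0 He].
exists (e / 2); first by rewrite divr_gt0.
pose rabs (y : 'rV[R]_n) : 'rV[R]_n := \row_i `|y 0 i|.
have rabs_cont : continuous rabs.
  apply: nonexpansive_continuous => a b d ab i; rewrite !mxE.
  by apply: le_lt_trans (ab i); exact: ler_dist_dist.
(* [fold] is constant on orbits, hence descends to a section. *)
pose fold x' := param c (rabs (local_coord c x')).
have rabs_act x' : dom c x' ->
    exists t, rabs (local_coord c x') = local_coord c (sc_act t x').
  move=> dx'.
  pose t : Z2 n := \row_i (if local_coord c x' 0 i < 0 then 1 else 0).
  exists (psi t); rewrite eqv // psiK; apply/rowP => i; rewrite !mxE.
  by case: ltP => [/ltr0_norm|/ger0_norm] ->; rewrite ?eqxx // oner_eq0.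
have rabs_cod x' : dom c x' -> cod c (rabs (local_coord c x')).
  move=> dx'; have [t ->] := rabs_act _ dx'.
  by apply: local_coord_cod; exact: inv.
have fold_act x' : dom c x' -> exists t, fold x' = sc_act t x'.
  move=> dx'; have [t tE] := rabs_act _ dx'.
  by exists t; rewrite /fold tE chartK //; exact: inv.
have fold_inv t x' : dom c x' -> fold (sc_act t x') = fold x'.
  move=> dx'; rewrite /fold eqv //; congr (param c _); apply/rowP => i.
  by rewrite !mxE; case: ifP => // _; rewrite normrN.
set S := [set _ | _].
have lift q : exists x', S q -> dom c x' /\ sc_proj x' = q.
  have [[cq qp]|nS] := pselect (S q); last by exists x.
  have [|x' dx' x'q] := He q _ cq; last by exists x'.
  by move=> i; rewrite distrC; apply: le_lt_trans (qp i) _; lra.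
have {lift}[lift liftP] := choice lift.
have foldE q x' : S q -> dom c x' -> sc_proj x' = q -> fold x' = fold (lift q).
  move=> Sq dx' x'q; have [dl lq] := liftP q Sq.
  have : sc_proj (lift q) = sc_proj x' by rewrite lq.
  by move/sc_proj_fiber => [t ->]; rewrite fold_inv.
have fold_dom x' : dom c x' -> dom c (fold x').
  by move=> dx'; have [t ->] := fold_act _ dx'; exact: inv.
have foldK x' : dom c x' -> fold (fold x') = fold x'.
  by move=> dx'; have [t tE] := fold_act _ dx'; rewrite {1}tE fold_inv.
exists (fold \o lift); split=> [q Sq /=|q Sq V nV].
  have [dl lq] := liftP q Sq.
  by have [t ->] := fold_act _ dl; rewrite sc_proj_act.
have [dl lq] := liftP q Sq; set x0 := fold (lift q).
have dx0 : dom c x0 by exact: fold_dom.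
have x0K : fold x0 = x0 by exact: foldK.
have x0q : sc_proj x0 = q.
  by rewrite /x0; have [t ->] := fold_act _ dl; rewrite sc_proj_act.
have fold_cvg : fold x' @[x' --> x0] --> x0.
  rewrite -{2}x0K; apply: (@cvg_comp _ _ _
    (fun x' => rabs (local_coord c x')) (param c)); last first.
    by apply: param_cvg; exact: rabs_cod.
  apply: (@cvg_comp _ _ _ (local_coord c) rabs); last exact: rabs_cont.
  exact: local_coord_cvg.
have H0 := sc_proj_open
  (@filterI _ _ (nbhs_filter x0) _ _ (dom_nbhs dx0) (fold_cvg _ nV)).
rewrite x0q in H0; apply: filterS H0 => q' H Sq'; have [cq' _] := Sq'.
by have [x' [dx' Vx'] x'q'] := H cq'; rewrite /= -(foldE q' x').
Unshelve. all: by end_near. Qed.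

Lemma glue_sections S k (c : R) s1 s2 :
  section_on (S `&` [set q : 'rV[R]_n | q 0 k <= c]) s1 ->
  section_on (S `&` [set q : 'rV[R]_n | c <= q 0 k]) s2 ->
  (forall q, S q -> q 0 k = c -> s1 q = s2 q) ->
  exists s, section_on S s.
Proof.
move=> [s1E s1c] [s2E s2c] s12.
exists (fun q : 'rV[R]_n => if q 0 k <= c then s1 q else s2 q).
split=> [q Sq|q Sq V].
  by case: leP => [qc|/ltW cq]; [apply: s1E|apply: s2E].
have coord (e : R) : 0 < e ->
    \forall q' \near q, `|q 0 k - (q' : 'rV[R]_n) 0 k| < e.
  by move=> e0; apply/nbhs_rowP; exists e.
case: (ltgtP (q 0 k) c) => [qc|cq|qc] nV.
- have := s1c q (conj Sq (ltW qc)) V nV.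
  have := coord (c - q 0 k); rewrite subr_gt0 => /(_ qc).
  apply: filterS2 => q'; rewrite ltr_norml => /andP[? ?] H Sq'.
  have q'c : q' 0 k <= c by lra.
  by rewrite q'c; exact: H.
- have := s2c q (conj Sq (ltW cq)) V nV.
  have := coord (q 0 k - c); rewrite subr_gt0 => /(_ cq).
  apply: filterS2 => q'; rewrite ltr_norml => /andP[? ?] H Sq'.
  have q'c : c < q' 0 k by lra.
  by rewrite leNgt q'c /=; apply: H; split=> //; exact: ltW.
have nV2 : nbhs (s2 q) V by rewrite -s12.
have q1 : q 0 k <= c by rewrite qc.
have q2 : c <= q 0 k by rewrite qc.
have := s2c q (conj Sq q2) V nV2; have := s1c q (conj Sq q1) V nV.
apply: filterS2 => q' H1 H2 Sq'.
by case: leP => [q'c|/ltW cq']; [apply: H1|apply: H2].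
Qed.

(** The sections over small boxes are glued along one coordinate after the
    other: once the first [k] coordinates are unrestricted, compactness of the
    range of the next one removes its restriction as well. *)
Lemma section_exists : exists s, section_on (@cube R n) s.
Proof.
pose box k (p : 'rV[R]_n) e : set 'rV[R]_n :=
  [set q | cube q /\ forall i : 'I_n, (k <= i)%N -> `|q 0 i - p 0 i| <= e].
suff P k : (k <= n)%N -> forall p, cube p -> exists2 e, 0 < e &
    exists s, section_on (box k p e) s.
  have c0 : cube (0 : 'rV[R]_n) by move=> i; rewrite mxE lexx ler01.
  have [e _ [s sP]] := P n (leqnn n) 0 c0; exists s.
  apply: section_on_sub sP => q cq; split=> // i.
  by rewrite leqNgt ltn_ord.
elim: k => [_ p /local_section[e e0 [s sP]]|k IH kn p pc].
  exists e => //; exists s; apply: section_on_sub sP => q [cq H]; split=> // i.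
  exact: H.
pose ko := Ordinal kn.
pose Q (a b : R) := exists2 e, 0 < e & exists s, section_on
  (box k.+1 p e `&` [set q : 'rV[R]_n | a <= q 0 ko <= b]) s.
suff [e e0 [s sP]] : Q 0 1.
  exists e => //; exists s; apply: section_on_sub sP => q Bq; split=> //.
  by case: Bq => cq _; exact: cq.
apply: cousin => [a c b a0 ac cb b1 [e1 e10 [s1 s1P]] [e2 e20 [s2 s2P]]|x x01].
  pose e := Num.min 1 (Num.min e1 e2).
  have ee1 : e <= e1 by rewrite !ge_min lexx !orbT.
  have ee2 : e <= e2 by rewrite !ge_min lexx !orbT.
  have e1' : e <= 1 by rewrite ge_min lexx.
  have e0 : 0 < e by rewrite !lt_min ltr01 e10 e20.
  exists e => //.
  set S := _ `&` _.
  have S1 : section_on (S `&` [set q : 'rV[R]_n | q 0 ko <= c]) s1.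
    apply: section_on_sub s1P => q [[[cq Bq] /andP[aq qb]] qc]; split.
      by split=> // i /Bq H; exact: le_trans ee1.
    by apply/andP.
  have S2 : section_on (S `&` [set q : 'rV[R]_n | c <= q 0 ko]) s2.
    apply: section_on_sub s2P => q [[[cq Bq] /andP[aq qb]] qc]; split.
      by split=> // i /Bq H; exact: le_trans ee2.
    by apply/andP.
  pose C := S `&` [set q : 'rV[R]_n | q 0 ko = c].
  have [t tP] : exists t, forall q, C q -> s1 q = sc_act t (s2 q).
    apply: (@sections_differ C).
    - by move=> q [[[]]].
    - move=> u v r [[[cu Bu] _] uc] [[[cv Bv] _] vc] r01; split; last first.
        by rewrite /= !mxE uc vc subrr mulr0 addr0.
      split; last first.
        rewrite /= !mxE uc vc subrr mulr0 addr0.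
        by apply/andP; split; apply: ltW.
      split=> [i|i ki]; rewrite !mxE.
        have /andP[? ?] := cu i; have /andP[? ?] := cv i.
        by apply/andP; split; [apply: segment_ge|apply: segment_le].
      have := Bu i ki; have := Bv i ki.
      rewrite !ler_norml => /andP[? ?] /andP[? ?].
      apply/andP; split; [rewrite lerBrDr|rewrite lerBlDr].
        by apply: segment_ge => //; lra.
      by apply: segment_le => //; lra.
    (* Move [p] a little towards the centre to leave the boundary, then set
       the coordinate [ko] to [c], which is strictly between 0 and 1. *)
    - pose h : 'rV[R]_n := const_mx 2^-1.
      have ho : open_cube h by move=> i; rewrite mxE; apply/andP; split; lra.
      have e01 : 0 < e <= 1 by rewrite e0.
      have ro := cube_to_open pc ho e01.
      pose r : 'rV[R]_n :=
        \row_i (if i == ko then c else (p + e *: (h - p)) 0 i).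
      exists r; split; last first.
        move=> i; rewrite mxE; case: eqP => _; last exact: ro.
        by apply/andP; split; lra.
      split; last by rewrite /= mxE eqxx.
      split; last by rewrite /= mxE eqxx; apply/andP; split; apply: ltW.
      split=> [i|i ki].
        rewrite mxE; case: eqP => _; last by have /andP[/ltW-> /ltW->] := ro i.
        by apply/andP; split; lra.
      rewrite mxE (_ : (i == ko) = false); last first.
        by apply/negbTE; apply: contraTneq ki => ->; rewrite /= ltnn.
      rewrite !mxE addrAC subrr add0r normrM (gtr0_norm e0) -[leRHS]mulr1.
      rewrite ler_wpM2l ?(ltW e0) // ler_norml.
      have /andP[? ?] := pc i.
      by apply/andP; split; lra.
    - apply: section_on_sub S2 => q [Sq qc]; split=> //.
      by rewrite /= qc.
    - apply: section_on_sub S1 => q [Sq qc]; split=> //.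
      by rewrite /= qc.
  (* After correction by [t], the two sections agree where [q_ko = c]. *)
  apply: (glue_sections S1 (section_on_act t S2)) => q Sq qc.
  exact: tP.
(* Locally in the coordinate [ko], apply the induction hypothesis at the
   point of the cube with this coordinate moved to [x]. *)
pose p' : 'rV[R]_n := \row_i (if i == ko then x else p 0 i).
have cp' : cube p' by move=> i; rewrite mxE; case: ifP.
have [e e0 [s sP]] := IH (ltnW kn) p' cp'; exists e => // a b a0 ax xb b1 ab.
exists e => //; exists s; apply: section_on_sub sP => q [[cq Bq] /andP[aq qb]].
split=> // i; rewrite leq_eqVlt mxE => /orP[/eqP ki|ki].
  have -> : i = ko by apply/val_inj.
  by rewrite eqxx ler_norml; apply/andP; split; lra.
rewrite ifN; first exact: Bq.
by apply: contraTneq ki => ->; rewrite /= ltnn.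
Qed.

End Sections.

(** * Isotropy groups classify small covers *)

Section Classification.
Variables (R : realType) (n : nat).

Lemma near_section (M N : small_cover R n) (s : 'rV[R]_n -> N) (x : M) V :
  section_on (@cube R n) s -> nbhs (s (sc_proj x)) V ->
  \forall x' \near x, V (s (sc_proj x')).
Proof.
move=> [_ sc] nV; have H := sc _ (sc_proj_cube x) V nV.
have H' : nbhs x [set x' | cube (sc_proj x') -> V (s (sc_proj x'))].
  exact: (@sc_proj_continuous _ _ M x _ H).
apply: filterS H' => x'; apply.
exact: sc_proj_cube.
Qed.

(** A point over [p] is [t . s p] with [t] determined up to the isotropy group
    of [p], so that [phi t . s' p] depends only on the point.  The map is
    continuous because it is so on each of the finitely many closed sheets
    [t . s(cube)]. *)
Lemma equivariant_map (M N : small_cover R n)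
    (phi : {additive Z2 n -> Z2 n}) (s : 'rV[R]_n -> M) (s' : 'rV[R]_n -> N) :
  section_on (@cube R n) s -> section_on (@cube R n) s' ->
  (forall p t, cube p -> t \in isotropy M p -> phi t \in isotropy N p) ->
  exists2 f : M -> N, continuous f &
    forall p t, cube p -> f (sc_act t (s p)) = sc_act (phi t) (s' p).
Proof.
move=> sP s'P iso; have [sE _] := sP; have [s'E _] := s'P.
have tau x : exists t, x = sc_act t (s (sc_proj x)).
  by apply/sc_proj_fiber; rewrite sE //; exact: sc_proj_cube.
have {tau}[tau tauP] := choice tau.
pose f (x : M) := sc_act (phi (tau x)) (s' (sc_proj x)).
have fE p t : cube p -> f (sc_act t (s p)) = sc_act (phi t) (s' p).
  move=> cp; rewrite /f; set x := sc_act t (s p).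
  have xp : sc_proj x = p by rewrite sc_proj_act sE.
  have : phi (tau x + t) \in isotropy N p.
    apply: iso => //; rewrite -{1}(sE p cp); apply/isotropyP.
    by rewrite addrC sc_actD -{1}xp -tauP sc_actK.
  rewrite -{1}(s'E p cp) => /isotropyP; rewrite raddfD xp sc_actD => e.
  by rewrite -[LHS](sc_actK (phi t)) sc_actC e.
exists f => // x V nV.
have H t : \forall x' \near x, x' = sc_act t (s (sc_proj x')) -> V (f x').
  have [xt|ne] := pselect (x = sc_act t (s (sc_proj x))).
    have nV' : nbhs (s' (sc_proj x)) (sc_act (phi t) @^-1` V).
      apply: (@sc_act_continuous _ _ N (phi t)).
      by rewrite -fE -?xt //; exact: sc_proj_cube.
    have H' := near_section s'P nV'; apply: filterS H' => x' Vx' x'E.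
    by rewrite x'E fE //; exact: sc_proj_cube.
  apply: contrapT => H; apply: ne; apply: hausdorff_eq => A B nA nB.
  apply: contrapT => AB; apply: H.
  have nB' : nbhs (s (sc_proj x)) (sc_act t @^-1` B).
    exact: (@sc_act_continuous _ _ M t _ _ nB).
  apply: filterS2 nA (near_section sP nB') => x' Ax' Bx' x'E.
  by exfalso; apply: AB; exists x' => //; rewrite x'E.
have := @filter_forall _ _
  (fun t (x' : M) => x' = sc_act t (s (sc_proj x')) -> V (f x')) _
  (nbhs_filter x) H.
by apply: filterS => x' /(_ (tau x')); apply.
Qed.

Lemma DJ_of_isotropy (M N : small_cover R n) (phi : {additive Z2 n -> Z2 n}) :
  is_aut phi ->
  (forall p t, cube p -> t \in isotropy M p <-> phi t \in isotropy N p) ->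
  DJ_equiv M N.
Proof.
move=> aphi iso; have [psi [phiK psiK]] := is_aut_inv aphi.
have [s sP] := section_exists M; have [s' s'P] := section_exists N.
have [f fc fE] := equivariant_map sP s'P (fun p t cp => proj1 (iso p t cp)).
have [|g gc gE] := equivariant_map (phi := psi) s'P sP.
  by move=> p t cp; rewrite -{1}(psiK t) => /iso; exact.
have orbit (L : small_cover R n) (r : 'rV[R]_n -> L) :
    section_on (@cube R n) r ->
    forall x : L, exists p t, cube p /\ x = sc_act t (r p).
  move=> [rE _] x; exists (sc_proj x).
  have /sc_proj_fiber[t xE] : sc_proj (r (sc_proj x)) = sc_proj x.
    by rewrite rE //; exact: sc_proj_cube.
  by exists t; split=> //; exact: sc_proj_cube.
exists phi, f; split=> //.
- split=> //; exists g; split=> // x.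
    have [p [t [cp ->]]] := orbit _ _ sP x; by rewrite fE // gE // phiK.
  have [p [t [cp ->]]] := orbit _ _ s'P x; by rewrite gE // fE // psiK.
- move=> t x; have [p [u [cp ->]]] := orbit _ _ sP x.
  by rewrite -sc_actD !fE // raddfD sc_actD.
- move=> x; have [p [u [cp ->]]] := orbit _ _ sP x.
  by rewrite fE // !sc_proj_act (proj1 sP) // (proj1 s'P).
Qed.

Lemma isotropy_of_DJ (M N : small_cover R n) : DJ_equiv M N ->
  exists2 phi : {additive Z2 n -> Z2 n}, is_aut phi & forall p t, cube p ->
    t \in isotropy M p <-> phi t \in isotropy N p.
Proof.
move=> [phi [f [aphi [_ [g [_ gK _]]] fact fproj]]].
exists phi => // p t /(@sc_proj_onto _ _ M)[x <-].
rewrite isotropyP -fproj isotropyP -fact.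
by split=> [->//|]; exact: (can_inj gK).
Qed.

End Classification.

(** * Signs, and smoothness of locally affine maps *)

Definition sgn (A : pzRingType) (a : 'F_2) : A := (-1) ^+ (a != 0).
Arguments sgn A a : clear implicits.

Lemma sgn0 A : sgn A 0 = 1. Proof. by rewrite /sgn eqxx. Qed.

Lemma sgn1 A : sgn A 1 = -1. Proof. by rewrite /sgn oner_eq0. Qed.

Lemma sgnD A a b : sgn A (a + b) = sgn A a * sgn A b.
Proof.
by case: (F2P a) => ->; case: (F2P b) => ->;
  rewrite ?addr0 ?add0r ?F2_addxx ?sgn0 ?sgn1 ?mulr1 ?mul1r // mulrNN mulr1.
Qed.

Lemma sgn_intr (A : pzRingType) a : (sgn int a)%:~R = sgn A a.
Proof. by rewrite /sgn rmorph_sign. Qed.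

Lemma sgn_F2 a : sgn 'F_2 a = 1.
Proof. by case: (F2P a) => ->; rewrite ?sgn0 ?sgn1 //; exact/val_inj. Qed.

Lemma sgn_norm (R : realType) a : `|sgn R a| = 1.
Proof. by rewrite /sgn normr_sign. Qed.

Section StdAct.
Variables (R : realType) (n : nat).
Implicit Types (x y : 'rV[R]_n) (t : Z2 n).

Lemma std_actE t x i : std_act t x 0 i = sgn R (t 0 i) * x 0 i.
Proof.
by rewrite mxE; case: (F2P (t 0 i)) => ->; rewrite ?sgn0 ?sgn1 ?mul1r ?mulN1r.
Qed.

Lemma std_act0 x : std_act 0 x = x.
Proof. by apply/rowP => i; rewrite std_actE mxE sgn0 mul1r. Qed.

Lemma std_actD s t x : std_act (s + t) x = std_act s (std_act t x).
Proof. by apply/rowP => i; rewrite !std_actE mxE sgnD mulrA. Qed.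

End StdAct.

Section LocallyAffine.
Variables (R : realType) (n : nat).
Implicit Types (U : set 'rV[R]_n) (f : 'rV[R]_n -> 'rV[R]_n).

(** The scalar [a] makes the class stable under differentiation: the derivative
    of such a map is again such a map, with [a = 0]. *)
Definition affine_near f (x : 'rV[R]_n) :=
  exists (a : R) (t : Z2 n) (b : 'rV[R]_n),
  \forall x' \near x, f x' = a *: std_act t x' + b :> 'rV[R]_n.

Lemma std_act_linear t (a : R) (x y : 'rV[R]_n) :
  std_act t (a *: x + y) = a *: std_act t x + std_act t y.
Proof. by apply/rowP => i; rewrite !mxE; case: ifP => _; ring. Qed.

Lemma affine_near_cvg f x : affine_near f x -> f @ x --> f x.
Proof.
move=> [a [t [b H]]] A; rewrite (nbhs_singleton H) => nA.
have affc : continuous (fun x' : 'rV[R]_n => a *: std_act t x' + b).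
  move=> z; apply: (@cvgD _ _ _ (nbhs z) (nbhs_filter z)
    (fun x' : 'rV[R]_n => a *: std_act t x') (fun=> b)); last exact: cvg_cst.
  apply: (@cvgZl_tmp _ _ _ (nbhs z) (nbhs_filter z) a (std_act t)).
  exact: (@std_act_continuous R n t z).
have H2 : nbhs x (f @^-1` A).
  by apply: filterS2 H (affc x A nA) => x' e; rewrite /preimage /= e.
exact: H2.
Qed.

Lemma affine_near_derive f (x v : 'rV[R]_n) (a : R) t b :
  (\forall x' \near x, f x' = a *: std_act t x' + b) ->
  derivable f x v /\ 'D_v f x = a *: std_act t v.
Proof.
move=> H.
have C : h^-1 *: ((f \o shift x) (h *: v) - f x) @[h --> 0^'] -->
    a *: std_act t v.
  apply: (@cvg_trans _ (cst (a *: std_act t v) @ (0 : R)^')); last first.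
    exact: cvg_cst.
  apply: near_eq_cvg; near=> h.
  have h0 : h != 0 by near: h; exact: nbhs_dnbhs_neq.
  have -> : (f \o shift x) (h *: v) = a *: std_act t (h *: v + x) + b.
    rewrite /=; near: h; apply: nbhs_dnbhs.
    have cc : (h *: v + x) @[h --> (0 : R)] --> x.
      rewrite -[X in _ --> X]add0r -(scale0r v).
      by apply: cvgD; [apply: cvgZr_tmp; exact: cvg_id|exact: cvg_cst].
    exact: cc H.
  rewrite (nbhs_singleton H) std_act_linear /cst.
  rewrite opprD addrACA subrr addr0 [a *: (_ + _)]scalerDr addrK !scalerA.
  by rewrite mulrCA mulVf // mulr1.
split; first by apply/cvg_ex; exists (a *: std_act t v).
exact: cvg_lim C.
Unshelve. all: by end_near. Qed.

Lemma affine_smooth U f : (forall x, U x -> affine_near f x) -> smooth_on U f.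
Proof.
move=> H k; elim: k f H => [|k IH] f H /=; split=> //.
- by move=> x; rewrite inE => /H; exact: affine_near_cvg.
- by move=> x; rewrite inE => /H; exact: affine_near_cvg.
move=> i; split=> [x Ux|].
  have [a [t [b Hx]]] := H x Ux.
  exact: (proj1 (affine_near_derive _ Hx)).
apply: IH => x Ux; have [a [t [b Hx]]] := H x Ux.
exists 0, 0, (a *: std_act t (delta_mx 0 i)).
apply: filterS (nbhs_interior Hx) => x' Hx'.
rewrite (proj2 (affine_near_derive (delta_mx 0 i) Hx')).
by rewrite scale0r add0r.
Qed.

End LocallyAffine.

(** * Folding the line onto the unit interval *)

Section TriangleWave.
Variable R : realType.
Implicit Types x y : R.

(** The even integer nearest to [x] is [2 * floor ((x + 1) / 2)]. *)
Definition dist_even x : R := `|x - 2 * (Num.floor ((x + 1) / 2))%:~R|.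

Lemma dist_even_le1 x : dist_even x <= 1.
Proof.
rewrite /dist_even; have := floor_itv ((x + 1) / 2).
by rewrite intrD ler_norml => /andP[? ?]; apply/andP; split; lra.
Qed.

Lemma dist_even_itv x : 0 <= dist_even x <= 1.
Proof. by rewrite dist_even_le1 normr_ge0. Qed.

Lemma int_norm_ge1 (k : int) : k != 0 -> 1 <= `|k%:~R : R|.
Proof.
by move=> k0; rewrite -intr_norm -[1]/(1%:~R) ler_int -gtz0_ge1 normr_gt0.
Qed.

Lemma dist_even_min x (k : int) : dist_even x <= `|x - 2 * k%:~R|.
Proof.
rewrite /dist_even; set l := Num.floor _.
have [->//|kl] := eqVneq k l; apply: (le_trans (dist_even_le1 x)).
have := @int_norm_ge1 (k - l); rewrite subr_eq0 => /(_ kl).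
have := dist_even_le1 x; rewrite /dist_even -/l intrB.
have := ler_distD x (2 * k%:~R) (2 * l%:~R).
rewrite -mulrBr normrM ger0_norm // (distrC (2 * _)); lra.
Qed.

Lemma dist_evenE x : exists k : int, dist_even x = `|x - 2 * k%:~R|.
Proof. by eexists. Qed.

Lemma dist_even_dist x y : `|dist_even x - dist_even y| <= `|x - y|.
Proof.
have H a b : dist_even a - dist_even b <= `|a - b|.
  have [k ->] := dist_evenE b; have := dist_even_min a k.
  by have := ler_distD b a (2 * k%:~R); lra.
have := H x y; have := H y x; rewrite (distrC y x) ler_norml => ? ?.
by apply/andP; split; lra.
Qed.

(** The maps [x |-> +-x + 2 m] form the group generated by the reflections of
    the line in the integers. *)
Lemma dist_even_sym (a : 'F_2) (m : int) x :
  dist_even (sgn R a * x + 2 * m%:~R) = dist_even x.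
Proof.
have H b l y : dist_even (sgn R b * y + 2 * l%:~R) <= dist_even y.
  have [k ->] := dist_evenE y.
  apply: (le_trans (dist_even_min _ (l + sgn int b * k))).
  rewrite intrD intrM sgn_intr.
  rewrite (_ : _ - _ = sgn R b * (y - 2 * k%:~R)); last by ring.
  by rewrite normrM sgn_norm mul1r.
apply/eqP; rewrite eq_le H /=.
have := H a (- (sgn int a * m)) (sgn R a * x + 2 * m%:~R).
rewrite mulrDr mulrA -sgnD F2_addxx sgn0 mul1r mulrNz intrM sgn_intr.
by rewrite (_ : x + _ + _ = x) //; ring.
Qed.

Lemma dist_even_id x : 0 <= x <= 1 -> dist_even x = x.
Proof.
move=> /andP[x0 x1]; apply/eqP; rewrite eq_le; apply/andP; split.
  by have := dist_even_min x 0; rewrite mulr0 subr0 ger0_norm.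
have [k ->] := dist_evenE x; have [k0|k0] := leP k 0.
  have : (k%:~R : R) <= 0 by rewrite lerz0.
  by move=> ?; rewrite ger0_norm; lra.
have : (1 : R) <= k%:~R by rewrite -[1]/(1%:~R) ler_int -gtz0_ge1.
by move=> ?; rewrite ler0_norm; lra.
Qed.

Lemma dist_even_sgn x :
  exists (a : 'F_2) (k : int), x = sgn R a * dist_even x + 2 * k%:~R.
Proof.
have [k ->] := dist_evenE x; have [h|h] := leP 0 (x - 2 * k%:~R).
  by exists 0, k; rewrite ger0_norm // sgn0 mul1r subrK.
by exists 1, k; rewrite ltr0_norm // sgn1; ring.
Qed.

Lemma dist_even_eq x y : dist_even x = dist_even y ->
  exists (a : 'F_2) (k : int), y = sgn R a * x + 2 * k%:~R.
Proof.
move=> e; have [a [k xE]] := dist_even_sgn x.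
have [b [l yE]] := dist_even_sgn y.
exists (a + b), (l - sgn int (a + b) * k).
rewrite intrB intrM sgn_intr {1}yE -e.
have {1}-> : dist_even x = sgn R a * (x - 2 * k%:~R).
  by rewrite {2}xE addrK mulrA -sgnD F2_addxx sgn0 mul1r.
rewrite sgnD; ring.
Qed.

Lemma dist_even_int x (c : int) : `|x - c%:~R| < 1 ->
  (x == c%:~R) = (dist_even x == 0) || (dist_even x == 1).
Proof.
move=> xc; apply/eqP/orP => [->|H].
  have [k kE] := dist_evenE (c%:~R).
  have e : dist_even c%:~R = (`|c - 2 * k|)%:~R.
    by rewrite kE intr_norm intrB intrM.
  have := dist_even_le1 c%:~R; rewrite e -[1]/(1%:~R) ler_int.
  rewrite -[0]/(0%:~R) !eqr_int; lia.
suff [l xl] : exists l : int, x = l%:~R.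
  move: xc; rewrite xl -intrB -intr_norm -[1]/(1%:~R) ltr_int => ?.
  by congr (_%:~R); lia.
have [a [k xE]] := dist_even_sgn x; case: H => /eqP H.
  by exists (2 * k); rewrite xE H mulr0 add0r intrM.
by exists (sgn int a + 2 * k); rewrite intrD intrM sgn_intr {1}xE H mulr1.
Qed.

End TriangleWave.

(** * The small cover of an acyclic digraph *)

Section Bott.
Variables (R : realType) (n : nat) (E : digraph n).
Implicit Types (x y : 'rV[R]_n) (m c : 'rV[int]_n) (t u : Z2 n).

Definition adjacency : 'M['F_2]_n := \matrix_(i, j) (edge E i j)%:R.

Definition mod2 m : Z2 n := map_mx intr m.

Definition deck_sign m : Z2 n := mod2 m *m adjacency.

(** These maps form the kernel of the homomorphism to [Z_2^n] that sends the
    reflection in [x_i = 0] to [e_i] and the one in [x_i = 1] to [e_i + b_i],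
    with [b_i] the [i]th row of [adjacency]: it maps [x |-> (-1)^t x + 2 m] to
    the sum of [t] and the [m_i b_i]. *)
Definition deck m x : 'rV[R]_n :=
  std_act (deck_sign m) x + \row_j (2 * (m 0 j)%:~R).

Lemma deckE m x j :
  deck m x 0 j = sgn R (deck_sign m 0 j) * x 0 j + 2 * (m 0 j)%:~R.
Proof. by rewrite mxE std_actE [(\row_i _) 0 j]mxE. Qed.

Definition flip t m : 'rV[int]_n := \row_j (sgn int (t 0 j) * m 0 j).

Lemma mod2_flip t m : mod2 (flip t m) = mod2 m.
Proof.
by apply/rowP => j; rewrite !mxE intrM sgn_intr sgn_F2 mul1r.
Qed.

Lemma mod2D m m' : mod2 (m + m') = mod2 m + mod2 m'.
Proof. by apply/rowP => j; rewrite !mxE rmorphD. Qed.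

Lemma deckD m m' x : deck m (deck m' x) = deck (m + flip (deck_sign m) m') x.
Proof.
apply/rowP => j; rewrite !deckE /deck_sign mod2D mod2_flip mulmxDl.
rewrite [(_ + _ : 'rV_n) 0 j]mxE sgnD [(m + _) 0 j]mxE rmorphD /=.
rewrite [flip _ _ 0 j]mxE intrM sgn_intr.
rewrite -/(deck_sign m); ring.
Qed.

Lemma deck0 x : deck 0 x = x.
Proof.
apply/rowP => j; rewrite deckE /deck_sign (_ : mod2 0 = 0) ?mul0mx; last first.
  by apply/rowP => i; rewrite !mxE.
by rewrite !mxE sgn0 mul1r mulr0 addr0.
Qed.

Lemma deckK m x : deck (- flip (deck_sign m) m) (deck m x) = x.
Proof.
have sgE : deck_sign (- flip (deck_sign m) m) = deck_sign m.
  rewrite /deck_sign (_ : mod2 (- _) = mod2 m) //.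
  rewrite -[RHS](mod2_flip (deck_sign m)) -[RHS]Z2_opp.
  by apply/rowP => j; rewrite !mxE rmorphN.
by rewrite deckD sgE addNr deck0.
Qed.

(** Sign changes normalize the deck group, hence act on the quotient. *)
Lemma std_act_deck t m x : std_act t (deck m x) = deck (flip t m) (std_act t x).
Proof.
apply/rowP => j; rewrite std_actE !deckE std_actE /deck_sign mod2_flip.
by rewrite [flip _ _ 0 j]mxE intrM sgn_intr; ring.
Qed.

Lemma deck_dist m x y j : `|deck m x 0 j - deck m y 0 j| = `|x 0 j - y 0 j|.
Proof.
by rewrite !deckE opprD addrACA subrr addr0 -mulrBr normrM sgn_norm mul1r.
Qed.

Lemma deck_continuous m : continuous (deck m).
Proof. by apply: nonexpansive_continuous => x y e xy i; rewrite deck_dist. Qed.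

Definition deck_rel x y : bool := `[< exists m, y = deck m x >].

Lemma deck_relP x y : reflect (exists m, y = deck m x) (deck_rel x y).
Proof. exact: asboolP. Qed.

Lemma deck_equiv_refl : reflexive deck_rel.
Proof. by move=> x; apply/deck_relP; exists 0; rewrite deck0. Qed.

Lemma deck_equiv_trans : transitive deck_rel.
Proof.
move=> y x z /deck_relP[m ->] /deck_relP[m' ->]; apply/deck_relP.
by rewrite deckD; eexists.
Qed.

Lemma deck_equiv_sym : symmetric deck_rel.
Proof.
have H x y : deck_rel x y -> deck_rel y x.
  move=> /deck_relP[m ->]; apply/deck_relP.
  by exists (- flip (deck_sign m) m); rewrite deckK.
by move=> x y; apply/idP/idP; exact: H.
Qed.

Canonical deck_equiv :=
  EquivRel deck_rel deck_equiv_refl deck_equiv_sym deck_equiv_trans.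

Definition bott := quotient_topology {eq_quot deck_equiv}%qT.
HB.instance Definition _ := Topological.on bott.

Definition bott_pi x : bott := \pi_{eq_quot deck_equiv}%qT x.

Lemma bott_piP x y : bott_pi x = bott_pi y <-> exists m, y = deck m x.
Proof.
split=> [/eqquotP/deck_relP //|H]; exact/eqquotP/deck_relP.
Qed.

Lemma bott_pi_deck m x : bott_pi (deck m x) = bott_pi x.
Proof. by apply/esym/bott_piP; exists m. Qed.

Lemma bott_pi_onto (q : bott) : exists x, bott_pi x = q.
Proof.
by exists (repr (q : {eq_quot deck_equiv}%qT)); rewrite /bott_pi reprK.
Qed.

Lemma bott_pi_continuous : continuous bott_pi.
Proof. exact: pi_continuous. Qed.

Lemma bott_pi_open x U : nbhs x U -> nbhs (bott_pi x) (bott_pi @` U).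
Proof.
rewrite nbhsE => -[W [oW Wx] WU]; rewrite nbhsE; exists (bott_pi @` W).
  split; last by exists x.
  have e : bott_pi @^-1` (bott_pi @` W) = \bigcup_m (deck m @^-1` W).
    apply/seteqP; split=> [y [z Wz /esym/bott_piP[m e]]|y [m _ Wy]].
      by exists m => //; rewrite /preimage /= -e.
    by exists (deck m y) => //; exact: bott_pi_deck.
  rewrite /open /= /quotient_open -/bott_pi.
  have : open (bott_pi @^-1` (bott_pi @` W)).
    rewrite e; apply: bigcup_open => m _; apply: open_comp => // y _.
    exact: deck_continuous.
  by [].
by move=> _ [y Wy <-]; exists y => //; exact: WU.
Qed.

Hypothesis acE : acyclic E.

Lemma acyclic_support (P : pred 'I_n) :
  (forall j, P j -> exists2 i, P i & edge E i j) -> forall j, ~~ P j.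
Proof.
move=> H j; apply/negP => Pj.
suff /setP/(_ j) : [set j | P j]%SET = finset.set0 by rewrite !inE Pj.
apply: (proj1 (acyclicP E) acE); apply/pred_closedP => i.
by rewrite inE => /H[k Pk e]; exists k; rewrite ?inE.
Qed.

Lemma row_adjacency_neq0 (v : Z2 n) j : (v *m adjacency) 0 j != 0 ->
  exists2 i, v 0 i != 0 & edge E i j.
Proof.
apply: contraNP => no; rewrite mxE; apply/eqP; apply: big1 => i _.
rewrite mxE; have [v0|v0] := eqVneq (v 0 i) 0; first by rewrite v0 mul0r.
by case: (boolP (edge E i j)) => e; rewrite ?mulr0 //; case: no; exists i.
Qed.

(** A coordinate on which [deck m] acts without sign change is translated by
    [2 m_j]; so a nonzero [m_j] forces a sign change, hence a predecessor [i]
    of [j] with [m_i] odd. *)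
Lemma deck_far m x : (forall j, `|deck m x 0 j - x 0 j| < 2) -> m = 0.
Proof.
move=> near; apply/rowP => j; rewrite mxE; apply/eqP.
rewrite -[_ == _]negbK; move: j.
apply: acyclic_support => j mj.
have : deck_sign m 0 j != 0.
  apply: contraNneq mj => sj; have := near j.
  rewrite deckE sj sgn0 mul1r addrAC subrr add0r normrM.
  rewrite ger0_norm // -[X in _ < X]mulr1 ltr_pM2l // -intr_norm.
  by rewrite -[1]/(1%:~R) ltr_int -[X in _ < X]add0r ltzD1 normr_le0.
move=> /row_adjacency_neq0[i mi e]; exists i => //.
by apply: contraNneq mi => mi; rewrite mxE mi.
Qed.

Lemma bott_pi_inj_near x y : (forall j, `|x 0 j - y 0 j| < 2) ->
  bott_pi x = bott_pi y -> x = y.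
Proof.
move=> xy /bott_piP[m yE]; have := @deck_far m x.
rewrite yE => ->; rewrite ?deck0 //.
by move=> j; rewrite -yE distrC.
Qed.

(** By [deck_far], at most one image of [x] lies within distance 1 of [y]; so
    if images of [x] come arbitrarily close to [y], one of them is [y]. *)
Lemma bott_hausdorff : hausdorff_space bott.
Proof.
move=> p q; have [x <-] := bott_pi_onto p; have [y <-] := bott_pi_onto q => cl.
have near (d : R) : 0 < d -> exists m, forall j, `|y 0 j - deck m x 0 j| < d.
  move=> d0; have d2 : 0 < d / 2 by rewrite divr_gt0.
  pose B (z : 'rV[R]_n) : set 'rV[R]_n :=
    [set w | forall j, `|z 0 j - w 0 j| < d / 2].
  have nB z : nbhs z (B z) by apply/nbhs_rowP; exists (d / 2).
  have [_ [[x' xx' <-] [y' yy' /esym/bott_piP[m y'E]]]] :=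
    cl _ _ (bott_pi_open (nB x)) (bott_pi_open (nB y)).
  exists m => j; have := xx' j; have := yy' j.
  rewrite y'E -(deck_dist m x) => h1 h2.
  apply: (le_lt_trans (ler_distD (deck m x' 0 j) _ _)).
  by rewrite (distrC (deck m x' 0 j)); lra.
have [m1 m1P] := near 1 ltr01; apply/bott_piP; exists m1.
apply/rowP => j; apply/eqP; rewrite -subr_eq0 -normr_le0 leNgt.
apply/negP => d0.
pose d := Num.min 1 `|y 0 j - deck m1 x 0 j|.
have [|m mP] := near d; first by rewrite lt_min ltr01.
suff e : deck m1 x = deck m x.
  by have := mP j; rewrite -e lt_min ltxx andbF.
apply: bott_pi_inj_near; last by rewrite !bott_pi_deck.
move=> i; have := m1P i; have := mP i; rewrite lt_min => /andP[h _] h1.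
apply: (le_lt_trans (ler_distD (y 0 i) _ _)).
by rewrite (distrC (deck m1 x 0 i)); lra.
Qed.

(** An even [m] gives a translation, so the translations by [4 Z^n] are deck
    transformations. *)
Lemma bott_compact : compact [set: bott].
Proof.
pose I2 : set R := `[-2, 2]%classic.
pose K : set 'rV[R]_n := [set x | forall i, I2 (x ord0 i)].
have cK : compact K.
  by apply: (@rV_compact _ n (fun=> I2)) => i; exact: segment_compact.
suff <- : bott_pi @` K = setT.
  apply: continuous_compact => //; apply: continuous_subspaceT.
  exact: bott_pi_continuous.
apply/seteqP; split=> // q _; have [x <-] := bott_pi_onto q.
pose k : 'rV[int]_n := \row_j - Num.floor ((x 0 j + 2) / 4).
exists (deck (k *+ 2) x); last exact: bott_pi_deck.
have s0 : deck_sign (k *+ 2) = 0.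
  by rewrite /deck_sign mulr2n mod2D Z2_addxx mul0mx.
move=> i; rewrite /I2 /= in_itv /= [(deck _ _) _ _]deckE s0.
rewrite [X in sgn R X]mxE sgn0 mul1r.
have := floor_itv ((x 0 i + 2) / 4).
rewrite mulr2n !mxE !intrD !mulrNz => /andP[h1 h2].
by apply/andP; split; lra.
Qed.

Definition corner c : 'rV[R]_n := map_mx intr c.

Definition unit_box c : set 'rV[R]_n :=
  [set x | forall i, `|x 0 i - corner c 0 i| < 1].

Definition bott_dom c : set bott := bott_pi @` unit_box c.

(** The value 0 is taken outside the domain of the chart only. *)
Definition bott_lift c (q : bott) : 'rV[R]_n :=
  xget 0 [set x | unit_box c x /\ bott_pi x = q].

Definition bott_coord c q := bott_lift c q - corner c.

Definition bott_param c y := bott_pi (corner c + y).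

Lemma bott_liftK c x : unit_box c x -> bott_lift c (bott_pi x) = x.
Proof.
move=> cx; rewrite /bott_lift.
case: xgetP => [z _ [cz zx]|/(_ x)]; last by case.
apply: bott_pi_inj_near zx => j.
apply: (le_lt_trans (ler_distD (corner c 0 j) _ _)).
have := cz j; have := cx j; rewrite (distrC (x 0 j)); lra.
Qed.

Lemma unit_box_nbhs c x : unit_box c x -> nbhs x (unit_box c).
Proof.
move=> cx.
have : \forall y \near x, forall i, `|(y : 'rV[R]_n) 0 i - corner c 0 i| < 1.
  apply: (@filter_forall _ _ (fun i y => `|y 0 i - corner c 0 i| < 1) _
    (nbhs_filter x)) => i.
  apply/nbhs_rowP; exists (1 - `|x 0 i - corner c 0 i|).
    by rewrite subr_gt0; exact: cx.
  move=> y /(_ i) xy; apply: (le_lt_trans (ler_distD (x 0 i) _ _)).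
  by rewrite (distrC (y 0 i)); lra.
by [].
Qed.

Lemma unit_box0 c y : unit_box 0 y <-> unit_box c (corner c + y).
Proof.
split=> H i; have := H i; rewrite !mxE subr0.
  by rewrite [_ + y 0 i]addrC addrK.
by rewrite [_ + y 0 i]addrC addrK.
Qed.

Lemma addr_continuous (v : 'rV[R]_n) : continuous (fun z => v + z : 'rV[R]_n).
Proof.
apply: nonexpansive_continuous => x y e xy i; rewrite !mxE.
by rewrite opprD addrACA subrr add0r.
Qed.

Lemma bott_dom_open c : open (bott_dom c).
Proof.
rewrite openE => _ [x cx <-]; exact: (bott_pi_open (unit_box_nbhs cx)).
Qed.

Lemma bott_cod_open : open (unit_box 0).
Proof. by rewrite openE => x; exact: unit_box_nbhs. Qed.

Lemma bott_coord_pi c x :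
  unit_box c x -> bott_coord c (bott_pi x) = x - corner c.
Proof. by move=> cx; rewrite /bott_coord bott_liftK. Qed.

Lemma bott_coord_cod c q : bott_dom c q -> unit_box 0 (bott_coord c q).
Proof.
move=> [x cx <-]; rewrite bott_coord_pi //; apply/(unit_box0 c).
by rewrite addrC subrK.
Qed.

Lemma bott_param_dom c y : unit_box 0 y -> bott_dom c (bott_param c y).
Proof. by move=> /(unit_box0 c) cy; exists (corner c + y). Qed.

Lemma bott_coordK c : {in bott_dom c, cancel (bott_coord c) (bott_param c)}.
Proof.
move=> q; rewrite inE => -[x cx <-]; rewrite bott_coord_pi //.
by rewrite /bott_param addrC subrK.
Qed.

Lemma bott_paramK c : {in unit_box 0, cancel (bott_param c) (bott_coord c)}.
Proof.
move=> y; rewrite inE => /(unit_box0 c) cy.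
by rewrite bott_coord_pi // addrC addrA addNr add0r.
Qed.

Lemma bott_coord_continuous c : {in bott_dom c, continuous (bott_coord c)}.
Proof.
move=> q; rewrite inE => -[x cx <-] V; rewrite bott_coord_pi // => nV.
have shift_cont : (fun z : 'rV[R]_n => z - corner c) @ x --> x - corner c.
  have -> : (fun z : 'rV[R]_n => z - corner c) = (fun z => - corner c + z).
    by apply/funext => z; rewrite addrC.
  by rewrite addrC; exact: addr_continuous.
have H := bott_pi_open
  (@filterI _ _ (nbhs_filter x) _ _ (unit_box_nbhs cx) (shift_cont _ nV)).
by apply: filterS H => _ [z [cz Vz] <-]; rewrite /preimage /= bott_coord_pi.
Qed.

Lemma bott_param_continuous c : {in unit_box 0, continuous (bott_param c)}.
Proof.
move=> y _; apply: (@continuous_comp _ _ _ (fun y => corner c + y) bott_pi).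
  exact: addr_continuous.
exact: bott_pi_continuous.
Qed.

Definition bott_chart c : chart R n bott :=
  Chart (bott_dom_open (c := c)) bott_cod_open (@bott_coord_cod c)
    (@bott_param_dom c) (@bott_coordK c) (@bott_paramK c)
    (@bott_coord_continuous c) (@bott_param_continuous c).

Lemma deck_add m x y : deck m (x + y) = deck m x + std_act (deck_sign m) y.
Proof.
apply/rowP => j; rewrite [RHS]mxE !deckE std_actE [(_ + _ : 'rV_n) 0 j]mxE.
ring.
Qed.

(** By [deck_far] a single deck transformation relates two lifts near a
    point, so that transition maps are locally affine. *)
Lemma bott_transition c d : smooth_transition (bott_chart c) (bott_chart d).
Proof.
apply: affine_smooth => y [/= cy [x dx /bott_piP[m mE]]].
have xE : x = deck (- flip (deck_sign m) m) (corner c + y) by rewrite mE deckK.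
set m' := - _ in xE.
exists 1, (deck_sign m'), (deck m' (corner c) - corner d).
have shift_cont :
    (fun y' => deck m' (corner c + y')) @ y --> deck m' (corner c + y).
  apply: (@continuous_comp _ _ _ (fun y' => corner c + y') (deck m')).
    exact: addr_continuous.
  exact: deck_continuous.
rewrite -xE in shift_cont.
have near : nbhs y ((fun y' => deck m' (corner c + y')) @^-1` unit_box d).
  exact: shift_cont (unit_box_nbhs dx).
apply: filterS near => y' dy'.
rewrite /= /bott_param -(bott_pi_deck m') bott_coord_pi //.
by rewrite deck_add scale1r [deck _ _ + std_act _ _]addrC -addrA.
Qed.

Definition bott_atlas : set (chart R n bott) := range bott_chart.

Lemma floor_unit_box x : unit_box (\row_j Num.floor (x 0 j)) x.
Proof.
move=> i; rewrite !mxE; have := floor_itv (x 0 i).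
by rewrite intrD ltr_norml => /andP[? ?]; apply/andP; split; lra.
Qed.

Lemma bott_atlas_cover (q : bott) : exists2 c, bott_atlas c & dom c q.
Proof.
have [x <-] := bott_pi_onto q; exists (bott_chart (\row_j Num.floor (x 0 j))).
  by eexists.
by exists x => //; exact: floor_unit_box.
Qed.

Lemma bott_atlas_compatible (c d : chart R n bott) :
  bott_atlas c -> bott_atlas d -> compatible c d.
Proof.
by move=> [c' _ <-] [d' _ <-]; split; exact: bott_transition.
Qed.

Definition bott_manifold : closed_manifold R n :=
  ClosedManifold bott_hausdorff bott_compact bott_atlas_cover
    bott_atlas_compatible.

Definition bott_act t (q : bott_manifold) : bott_manifold :=
  bott_pi (std_act t (repr (q : {eq_quot deck_equiv}%qT))).

Lemma bott_act_pi t x : bott_act t (bott_pi x) = bott_pi (std_act t x).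
Proof.
have /bott_piP[m xE] :
    bott_pi (repr (bott_pi x : {eq_quot deck_equiv}%qT)) = bott_pi x.
  by rewrite /bott_pi reprK.
rewrite [in RHS]xE std_act_deck; exact/esym/bott_pi_deck.
Qed.

Lemma bott_act0 q : bott_act 0 q = q.
Proof. by have [x <-] := bott_pi_onto q; rewrite bott_act_pi std_act0. Qed.

Lemma bott_actD s t q : bott_act (s + t) q = bott_act s (bott_act t q).
Proof. by have [x <-] := bott_pi_onto q; rewrite !bott_act_pi std_actD. Qed.

(** Reflections in the hyperplanes [x_i = c_i] through an integral point [c]
    act on the quotient through this automorphism. *)
Definition reflection c : 'M['F_2]_n := 1%:M + diag_mx (mod2 c) *m adjacency.

Lemma reflection_act c u x :
  bott_pi (std_act (u *m reflection c) x) =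
  bott_pi (corner c + std_act u (x - corner c)).
Proof.
pose m : 'rV[int]_n := \row_i (if u 0 i == 0 then 0 else c 0 i).
have sgm : deck_sign m = u *m diag_mx (mod2 c) *m adjacency.
  rewrite /deck_sign mul_mx_diag; congr (_ *m _); apply/rowP => i.
  rewrite !mxE; have [->|] := eqVneq (u 0 i) 0; first by rewrite mul0r.
  by rewrite F2_neq0 => /eqP ->; rewrite mul1r.
apply/bott_piP; exists m; apply/rowP => i.
rewrite deckE std_actE mulmxDr mulmx1 mulmxA -sgm [(u + _) 0 i]mxE sgnD.
rewrite mulrA [_ * (_ * sgn _ _)]mulrCA -sgnD F2_addxx sgn0 mulr1.
rewrite [LHS]mxE std_actE !mxE.
case: (F2P (u 0 i)) => ->; rewrite ?eqxx ?oner_eq0 ?sgn0 ?sgn1; ring.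
Qed.

Lemma reflection_inj c : injective (fun u : Z2 n => u *m reflection c).
Proof.
have ker u : u *m reflection c = 0 -> u = 0.
  rewrite mulmxDr mulmx1 mulmxA => /eqP; rewrite addr_eq0 Z2_opp => /eqP uE.
  apply/rowP => j; rewrite mxE; apply/eqP; rewrite -[_ == _]negbK; move: j.
  apply: acyclic_support => j; rewrite {1}uE => /row_adjacency_neq0[i ui e].
  exists i => //; apply: contraNneq ui => ui.
  by rewrite mul_mx_diag mxE ui mul0r.
move=> u v /eqP; rewrite -subr_eq0 -mulmxBl => /eqP/ker/eqP.
by rewrite subr_eq0 => /eqP.
Qed.

Lemma reflection_aut c : exists2 phi : {additive Z2 n -> Z2 n}, is_aut phi &
  forall t, phi t *m reflection c = t.
Proof.
pose psi : {additive Z2 n -> Z2 n} := mulmxr (reflection c).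
have bpsi : is_aut psi by apply: injF_bij; exact: reflection_inj.
have [phi [psiK phiK]] := is_aut_inv bpsi.
by exists phi; [exists psi|move=> t; exact: phiK].
Qed.

Lemma reflection_box c u x : unit_box c x ->
  unit_box c (corner c + std_act u (x - corner c)).
Proof.
move=> cx i; rewrite [X in X - _]mxE addrAC subrr add0r std_actE normrM.
rewrite sgn_norm mul1r; have := cx i; by rewrite !mxE.
Qed.

Lemma bott_chart_standard c : standard_chart bott_act (bott_chart c).
Proof.
have [phi aphi phiE] := reflection_aut c.
have actE t x : bott_act t (bott_pi x) =
    bott_pi (corner c + std_act (phi t) (x - corner c)).
  by rewrite bott_act_pi -{1}(phiE t) reflection_act.
split.
- by move=> _ [d _ <-]; split; exact: bott_transition.
- move=> t _ [x cx <-]; rewrite actE.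
  by eexists; last reflexivity; exact: reflection_box.
exists phi => // t _ [x cx <-].
rewrite actE /= !bott_coord_pi //; last exact: reflection_box.
by rewrite addrC addKr.
Qed.

Lemma bott_standard q : exists2 c, standard_chart bott_act c & dom c q.
Proof.
have [_ [c _ <-] cq] := bott_atlas_cover q.
by exists (bott_chart c) => //; exact: bott_chart_standard.
Qed.

Definition bott_proj (q : bott_manifold) : 'rV[R]_n :=
  map_mx (@dist_even R) (repr (q : {eq_quot deck_equiv}%qT)).

Lemma bott_proj_pi x : bott_proj (bott_pi x) = map_mx (@dist_even R) x.
Proof.
have /bott_piP[m xE] :
    bott_pi (repr (bott_pi x : {eq_quot deck_equiv}%qT)) = bott_pi x.
  by rewrite /bott_pi reprK.
by apply/rowP => j; rewrite [LHS]mxE [RHS]mxE [in RHS]xE deckE dist_even_sym.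
Qed.

Lemma bott_proj_continuous : continuous bott_proj.
Proof.
have H : continuous (fun x => bott_proj (bott_pi x)).
  apply: nonexpansive_continuous => x y e xy i; rewrite !bott_proj_pi !mxE.
  exact: le_lt_trans (dist_even_dist _ _) (xy i).
exact: (proj2 (@quotient_continuous _ _ _ (bott_proj : bott -> _)) H).
Qed.

Lemma bott_proj_range : range bott_proj = @cube R n.
Proof.
apply/seteqP; split=> [_ [q _ <-]|p cp].
  have [x <-] := bott_pi_onto q; move=> i; rewrite bott_proj_pi mxE.
  exact: dist_even_itv.
exists (bott_pi p) => //; rewrite bott_proj_pi; apply/rowP => i; rewrite mxE.
exact: dist_even_id.
Qed.

Lemma bott_proj_fiber p q :
  bott_proj p = bott_proj q <-> exists t, q = bott_act t p.
Proof.
have [x <-] := bott_pi_onto p; have [y <-] := bott_pi_onto q.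
rewrite !bott_proj_pi; split=> [/rowP e|[t]]; last first.
  rewrite bott_act_pi => /bott_piP[m xE]; apply/rowP => i; rewrite !mxE.
  rewrite -(dist_even_sym (deck_sign m 0 i) (m 0 i) (y 0 i)) -deckE.
  rewrite -xE std_actE.
  by rewrite -(dist_even_sym (t 0 i) 0 (x 0 i)) mulr0 addr0.
have aE i : exists a : 'F_2 * int,
    y 0 i = sgn R a.1 * x 0 i + 2 * a.2%:~R.
  have := e i; rewrite !mxE => /dist_even_eq[a [m yE]]; by exists (a, m).
have {aE}[a aP] := choice aE.
pose m : 'rV[int]_n := \row_i (a i).2.
exists (deck_sign m + \row_i (a i).1).
rewrite bott_act_pi -[RHS](bott_pi_deck m).
congr bott_pi; apply/rowP => i; rewrite deckE std_actE mulrA -sgnD.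
by rewrite [(deck_sign m + _) 0 i]mxE addrA F2_addxx add0r !mxE; exact: aP.
Qed.

(** The charts at integral points have the right codimension by construction,
    and [card_isotropy] carries the equality over to any other standard
    chart. *)
Lemma bott_corners (c : chart R n bott_manifold) q :
  standard_chart bott_act c -> dom c q ->
  orthant_codim (local_coord c q) = cube_codim (bott_proj q).
Proof.
have card d : standard_chart bott_act d -> dom d q ->
    #|[set t | `[< bott_act t q = q >]]%SET| =
    (2 ^ orthant_codim (local_coord d q))%N.
  by move=> [_ inv [phi aphi eqv]] dq; exact: (card_isotropy aphi inv eqv dq).
move=> sc /(card _ sc); have [_ [d _ <-] dq] := bott_atlas_cover q.
rewrite (card _ (bott_chart_standard d) dq) => /eqP.
rewrite eqn_exp2l // => /eqP <-; have [x dx xq] := dq.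
rewrite /= -xq bott_coord_pi // bott_proj_pi; apply: eq_card => i.
have := dx i; rewrite !inE !mxE => /dist_even_int <-.
by rewrite subr_eq0.
Qed.

Definition bott_cover : small_cover R n :=
  SmallCover bott_act0 bott_actD bott_standard bott_proj_continuous
    bott_proj_range bott_proj_fiber bott_corners.

Definition bott_lam (i : 'I_n) (b : bool) : Z2 n :=
  delta_mx 0 i + (if b then row i adjacency else 0).

Lemma no_loop i : ~~ edge E i i.
Proof.
apply/negP => e; have := @acyclic_support (pred1 i).
have H j : pred1 i j -> exists2 k, pred1 i k & edge E k j.
  by rewrite /= => /eqP ->; exists i => //=.
by move=> /(_ H i) /=; rewrite eqxx.
Qed.

Lemma bott_lam_isotropy i b :
  bott_lam i b \in isotropy bott_cover (facet_center R i b).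
Proof.
set p := facet_center R i b.
have <- : bott_proj (bott_pi p) = p.
  rewrite bott_proj_pi; apply/rowP => j; rewrite mxE; apply: dist_even_id.
  exact: (facet_cube (facet_center_in R i b)).
apply/(isotropyP (M := bott_cover)); rewrite /= bott_act_pi /bott_lam.
have pi : p 0 i = b%:R by rewrite mxE eqxx.
clearbody p; case: b pi => pi; last first.
  congr bott_pi; apply/rowP => j; rewrite addr0 std_actE mxE eqxx /=.
  have [->|_] := eqVneq j i; last by rewrite sgn0 mul1r.
  by rewrite pi mulr0.
rewrite -(bott_pi_deck (delta_mx 0 i)); congr bott_pi.
have -> : row i adjacency = deck_sign (delta_mx 0 i).
  rewrite /deck_sign (_ : mod2 _ = delta_mx 0 i) ?rowE //.
  by apply/rowP => j; rewrite !mxE eqxx /=; case: (j == i).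
apply/rowP => j; rewrite deckE std_actE mulrA -sgnD.
rewrite [X in sgn R X]addrC [(delta_mx 0 i + _) 0 j]mxE -addrA F2_addxx addr0.
rewrite !mxE eqxx /=; have [->|_] := eqVneq j i.
  by rewrite sgn1 pi /= mulr1; ring.
by rewrite sgn0 mul1r mulr0 addr0.
Qed.

Lemma bott_char_fun : char_fun bott_cover bott_lam.
Proof.
have [lam lamP] := char_fun_exists bott_cover.
suff -> : bott_lam = lam by [].
apply/funext => i; apply/funext => b.
have := bott_lam_isotropy i b.
have [_ /(_ _ (facet_center_in R i b)) ->] := lamP i b.
rewrite !inE => /orP[/eqP/rowP/(_ i)|/eqP //].
rewrite !mxE !eqxx /=; case: (b) => /eqP.
  by rewrite mxE mxE (negbTE (no_loop i)) addr0 oner_eq0.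
by rewrite mxE addr0 oner_eq0.
Qed.

End Bott.

(** * Small covers over the cube and acyclic digraphs *)

Section CubeClassification.
Variables (R : realType) (n : nat).

Lemma adjacency_inj (E E' : digraph n) : adjacency E = adjacency E' -> E = E'.
Proof.
move=> /matrixP e; apply/setP => -[i j]; have := e i j; rewrite !mxE /edge.
by case: ((i, j) \in E); case: ((i, j) \in E').
Qed.

Lemma additive_delta (phi : {additive Z2 n -> Z2 n}) t :
  phi t = \sum_i t 0 i *: phi (delta_mx 0 i).
Proof.
rewrite {1}(row_sum_delta t) raddf_sum; apply: eq_bigr => i _; exact: F2_scale.
Qed.

(** The two characteristic functions agree on the facets [p_i = 0], where they
    take the values [e_i]; so an automorphism relating them fixes a basis. *)
Lemma bott_DJ_inj (E E' : digraph n) (aE : acyclic E) (aE' : acyclic E') :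
  DJ_equiv (bott_cover R aE) (bott_cover R aE') -> E = E'.
Proof.
move=> /isotropy_of_DJ[phi aphi iso].
have H i b : phi (bott_lam E i b) = bott_lam E' i b.
  have pF := @facet_center_in R n i b; set p := facet_center R i b in pF.
  have [lN0 isoE] := bott_char_fun R aE i b.
  have [_ isoE'] := bott_char_fun R aE' i b.
  have := proj1 (iso p (bott_lam E i b) (facet_cube pF)).
  rewrite isoE // isoE' // !inE eqxx orbT => /(_ isT)/orP[/eqP|/eqP //].
  by rewrite -(raddf0 phi) => /(bij_inj aphi) l0; rewrite l0 eqxx in lN0.
have phi_id t : phi t = t.
  rewrite additive_delta [RHS]row_sum_delta; apply: eq_bigr => i _.
  by have := H i false; rewrite /bott_lam !addr0 => ->.
apply: adjacency_inj; apply/row_matrixP => i; have := H i true.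
by rewrite phi_id => /addrI.
Qed.

(** The facets [p_i = 0] meet at a vertex, so an automorphism takes their values
    to the standard basis; the values on the opposite facets are then read as
    the rows of an adjacency matrix. *)
Lemma bott_DJ_onto (M : small_cover R n) :
  exists (E : digraph n) (aE : acyclic E), DJ_equiv M (bott_cover R aE).
Proof.
have [lam lamP] := char_fun_exists M.
pose vertex (S : {set 'I_n}) : 'rV[R]_n := \row_j (j \in S)%:R.
have vertex_cube S : cube (vertex S).
  by move=> j; rewrite mxE; case: (j \in S); rewrite lexx ler01.
have span (S : {set 'I_n}) (t : Z2 n) :
    exists u : Z2 n, t = \sum_j u 0 j *: lam j (j \in S).
  have : t \in isotropy M (vertex S).
    have [x xS] := @sc_proj_onto _ _ M _ (vertex_cube S).
    rewrite -xS; apply/isotropyP.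
    have [c sc dx] := sc_standard x; have [_ inv [phi _ eqv]] := sc.
    apply/(standard_chart_fix _ inv eqv dx) => i.
    have := sc_proj_corners sc dx; rewrite xS /cube_codim.
    rewrite [RHS](_ : _ = #|'I_n|); last first.
      apply: eq_card => j.
      by rewrite !inE mxE; case: (j \in S); rewrite eqxx ?orbT.
    move=> /fintype.subset_cardP/(_ (fintype.subset_predT _))/(_ i).
    by rewrite !inE => ->.
  move/(isotropy_span lamP) => /(_ (vertex_cube S))[u ->]; exists u.
  apply: eq_big => [j|j _].
    by rewrite /on_facet mxE; case: (j \in S); rewrite eqxx ?orbT.
  by rewrite mxE; case: (j \in S); rewrite ?eqxx // eq_sym oner_eq0.
pose L : 'M['F_2]_n := \matrix_i lam i false.
have LE (u : Z2 n) : u *m L = \sum_j u 0 j *: lam j false.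
  by rewrite mulmx_sum_row; apply: eq_bigr => j _; rewrite rowK.
pose psi : {additive Z2 n -> Z2 n} := mulmxr L.
have apsi : is_aut psi.
  apply: injF_bij; apply: surj_inj => t; have [u ->] := span finset.set0 t.
  by exists u; rewrite /= LE; apply: eq_bigr => j _; rewrite inE.
have [phi [psiK phiK]] := is_aut_inv apsi.
have phi0 i : phi (lam i false) = delta_mx 0 i.
  by rewrite -[RHS]psiK /= -rowE rowK.
pose b i := phi (lam i true) + delta_mx 0 i.
have phi1 i c : phi (lam i c) = delta_mx 0 i + (if c then b i else 0).
  by case: c; rewrite ?addr0 ?phi0 // /b addrCA Z2_addxx addr0.
have acE : acyclic (digraph_of b).
  apply: span_acyclic => S t; have [u uE] := span S (psi t).
  exists u; rewrite -[LHS]psiK uE raddf_sum; apply: eq_bigr => j _.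
  by rewrite F2_scale phi1.
exists (digraph_of b), acE; apply: (@DJ_of_isotropy _ _ _ _ phi).
  by exists psi.
have lamE i c : phi (lam i c) = bott_lam (digraph_of b) i c.
  rewrite phi1 /bott_lam; case: c => //; congr (_ + _).
  apply/rowP => j; rewrite [RHS]mxE [RHS]mxE edge_digraph_of.
  by case: (F2P (b i 0 j)) => ->.
have phiI : injective phi by exact: can_inj phiK.
move=> p t cp; rewrite (isotropy_span lamP) //.
rewrite (isotropy_span (@bott_char_fun R _ _ acE)) //.
split=> -[u uE]; exists u.
  by rewrite uE raddf_sum; apply: eq_bigr => j _; rewrite F2_scale lamE.
apply: phiI; rewrite uE raddf_sum; apply: eq_bigr => j _.
by rewrite F2_scale lamE.
Qed.

End CubeClassification.

Theorem theorem2p2 (R : realType) (n : nat) (n_gt0 : (0 < n)%N) :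
  has_classes (@DJ_equiv R n) #|acyclic_digraphs n|.
Proof.
have acP (k : 'I_#|acyclic_digraphs n|) : acyclic (enum_val k).
  by have := enum_valP k; rewrite inE => /asboolP.
exists (fun k => @DJ_equiv R n (bott_cover R (acP k))); split=> [k l e|C].
  apply/enum_val_inj/(bott_DJ_inj (R := R) (aE := acP k) (aE' := acP l)).
  by rewrite e; exact: DJ_refl.
split=> [[M ->]|[k ->]]; last by exists (bott_cover R (acP k)).
have [E [aE ME]] := bott_DJ_onto M.
have Eac : E \in acyclic_digraphs n by rewrite inE; exact/asboolP.
pose k := enum_rank_in Eac E.
have kE : enum_val k = E by rewrite enum_rankK_in.
exists k; have Mk : DJ_equiv M (bott_cover R (acP k)).
  move: (acP k); rewrite kE => aE'.
  by rewrite (Prop_irrelevance aE' aE).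
apply/funext => N; apply/propext; split=> H.
  exact: DJ_trans (DJ_sym Mk) H.
exact: DJ_trans Mk H.
Qed.
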